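(* Let $\epsilon\in(0,1)$ and let $S\subseteq\mathbb{N}$ be any finite nonempty set. Then $$z_S^{(0,1-\epsilon)}\leq \frac{1}{2\pi}\left(\log\left(\frac{2}{\epsilon}\right)+\frac{4}{\sqrt{\epsilon}}-4\right),$$ where $\log$ is the natural logarithm.
   Context: $\mathbb{N}=\{0,1,2,\dots\}$. For a finite nonempty set $S=\{e_1,\dots,e_k\}\subseteq\mathbb{N}$ (distinct elements), let $f_S(x)=\sum_{i=1}^k a_i x^{e_i}$, where $a_1,\dots,a_k$ are independent standard normal random variables. For an open interval $I\subseteq(0,\infty)$, $z_S^I$ denotes the expected number of zeros of $f_S$ in $I$. *)

(* Defs.v *)
From Stdlib Require Import Reals List ClassicalEpsilon.
Import ListNotations.
Open Scope R_scope.

(* f_S(x) = sum_i a_i x^{e_i}, where s = [e_1; ...; e_k] lists the elements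
   of S and a = [a_1; ...; a_k] the coefficients. *)
Definition poly_eval (s : list nat) (a : list R) (x : R) : R :=
  fold_right Rplus 0 (map (fun p => fst p * x ^ snd p) (combine a s)).

Definition is_zero_list (s : list nat) (a : list R) (lo hi : R) (l : list R) : Prop :=
  NoDup l /\ forall x, In x l <-> (lo < x < hi /\ poly_eval s a x = 0).

(* Number of zeros of f_S in (lo, hi); conventionally 0 when the zero set is
   infinite (this only happens on the null event a = 0). *)
Definition nzeros (s : list nat) (a : list R) (lo hi : R) : R :=
  match excluded_middle_informative (exists l, is_zero_list s a lo hi l) with
  | left H => INR (length (proj1_sig (constructive_indefinite_description _ H)))
  | right _ => 0
  end.

Definition gauss_density (t : R) : R := exp (- (t ^ 2) / 2) / sqrt (2 * PI).

Definition improper_int (f : R -> R) (v : R) : Prop :=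
  forall eps, 0 < eps -> exists M, forall a b, a <= - M -> M <= b ->
    exists pr : Riemann_integrable f a b, Rabs (RiemannInt pr - v) < eps.

(* gauss_exp n F v : the expectation of F(a_1,...,a_n), with a_i i.i.d.
   standard normal, exists (as an iterated improper Riemann integral against
   the Gaussian density) and equals v. *)
Fixpoint gauss_exp (n : nat) (F : list R -> R) (v : R) : Prop :=
  match n with
  | O => v = F nil
  | S m => exists g : R -> R,
      (forall t, gauss_exp m (fun l => F (t :: l)) (g t)) /\
      improper_int (fun t => g t * gauss_density t) v
  end.

Definition expected_zeros (s : list nat) (lo hi : R) (v : R) : Prop :=
  gauss_exp (length s) (fun a => nzeros s a lo hi) v.

(* Main.v *)
Require Import Defs.
From Stdlib Require Import Reals List.
From Stdlib Require Import Lra Lia Psatz ClassicalEpsilon FinFun Ranalysis5.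
From mathcomp Require Import ssreflect.
From Coquelicot Require Import Coquelicot.
Import ListNotations.
Open Scope general_if_scope.
Open Scope R_scope.

(** Condition on all coefficients but the last: [f_S] vanishes at [x > 0] iff the last
    coefficient equals a generalised polynomial [h(x)] in the others, so by the Banach
    indicatrix the conditional expected number of zeros in [(0, r)] is the integral of
    [|h'| phi(h)], with [phi] the Gaussian density.  This is uniformly continuous in the
    remaining coefficients on each stratum (coefficient zero, or bounded away from zero),
    which gives the existence of the iterated Riemann integrals without any Lebesgue theory.

    For the bound, the integral is replaced by left Riemann sums and
    [|h'| <= (lam h'^2 + 1/lam) / 2] makes the expectation at each node an explicit Gaussian
    integral, at most [sqrt (Var / x^2) / sqrt (2 PI)], where [Var] is the variance of the
    exponent under weights proportional to [x^(2e)].  The variance is at most the second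
    moment about [min S], so [Var / x^2 <= sum_n n^2 u^(n-1) <= (1+u)/(1-u)^3] with [u = x^2];
    the square root of this, divided by [sqrt (2 PI)], is at most
    [(1/(1-x) + 2 (1-x)^(-3/2)) / (2 PI)], which integrates to the claim.  *)

(** * Improper integrals and the Gaussian integral *)

(** The definition asks every inner integral to exist at each value of the outer coefficients, so no
    null set of vanishing coefficients can be discarded. As a coefficient tends to 0, a zero of the
    polynomial can leave the interval through x = 0; this is why the conditional count jumps between
    strata and why moduli of continuity are taken stratum by stratum. In each single variable the
    bad set is just the point 0, which is harmless for a bounded integrand.

    Expectation and integration in x are never exchanged. On a compact box of coefficients one
    finite set of nodes approximates the x-integral uniformly, and a finite sum commutes with
    expectation by linearity. What lies outside the box has small Gaussian mass and costs little,
    because the conditional count has a bound that depends on the number of terms only.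

    The quadratic majorant of |h'| turns an absolute value into a polynomial, whose Gaussian
    integrals are elementary. Choosing [lam] separately at each node balances its two halves, so
    that nothing is lost against Cauchy-Schwarz. *)

Lemma improper_int_RInt f v : improper_int f v <->
  forall eps, 0 < eps -> exists M, 0 <= M /\ forall a b, a <= - M -> M <= b ->
    ex_RInt f a b /\ Rabs (RInt f a b - v) < eps.
Proof.
  split; intros H eps He; destruct (H eps He) as [M HM].
  - exists (Rmax M 0). split; [apply Rmax_r|]. intros a b Ha Hb.
    pose proof (Rmax_l M 0).
    destruct (HM a b ltac:(lra) ltac:(lra)) as [pr Hpr].
    split; [now apply ex_RInt_Reals_1|]. now rewrite <- (RInt_Reals f a b pr) in Hpr.
  - exists M. intros a b Ha Hb. destruct HM as [_ HM].
    destruct (HM a b Ha Hb) as [H1 H2].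
    exists (ex_RInt_Reals_0 _ _ _ H1). now rewrite <- RInt_Reals.
Qed.

Lemma ex_RInt_sub (f : R -> R) a b c d :
  a <= c -> c <= d -> d <= b -> ex_RInt f a b -> ex_RInt f c d.
Proof.
  intros H1 H2 H3 H. apply: (ex_RInt_Chasles_2 f a c d); [lra|].
  apply: (ex_RInt_Chasles_1 f a d b); [lra|assumption].
Qed.

Lemma RInt_split (f : R -> R) a b c :
  ex_RInt f a b -> ex_RInt f b c -> (RInt f a c : R) = RInt f a b + RInt f b c.
Proof. intros H1 H2. symmetry. exact (RInt_Chasles f a b c H1 H2). Qed.

Lemma is_RInt_split (f : R -> R) a b c (u v : R) :
  is_RInt f a b u -> is_RInt f b c v -> is_RInt f a c (u + v).
Proof. exact (is_RInt_Chasles f a b c u v). Qed.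

Lemma is_RInt_FTC (F f : R -> R) a b : a <= b -> (forall x, a <= x <= b -> is_derive F x (f x)) ->
  (forall x, a <= x <= b -> continuous f x) -> is_RInt f a b (F b - F a).
Proof.
  intros Hab HF Hf. apply: (is_RInt_derive F f a b); rewrite Rmin_left // Rmax_right //.
Qed.

Lemma improper_int_ex f v : improper_int f v -> forall a b, ex_RInt f a b.
Proof.
  intros H a b.
  destruct (proj1 (improper_int_RInt f v) H 1 Rlt_0_1) as [M [HM0 HM]].
  assert (forall a b, a <= b -> ex_RInt f a b) as K.
  { intros c d Hcd.
    apply ex_RInt_sub with (Rmin c (-M)) (Rmax d M); [apply Rmin_l|lra|apply Rmax_l|].
    apply HM; [apply Rmin_r|apply Rmax_r]. }
  destruct (Rle_dec a b); [now apply K|]. apply ex_RInt_swap, K; lra.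
Qed.

Lemma improper_int_plus f g v w :
  improper_int f v -> improper_int g w -> improper_int (fun t => f t + g t) (v + w).
Proof.
  intros Hf Hg. pose proof (improper_int_ex _ _ Hf) as Ef.
  pose proof (improper_int_ex _ _ Hg) as Eg.
  apply improper_int_RInt. intros eps He.
  destruct (proj1 (improper_int_RInt f v) Hf (eps/2) ltac:(lra)) as [M [HM0 HM]].
  destruct (proj1 (improper_int_RInt g w) Hg (eps/2) ltac:(lra)) as [M' [HM0' HM']].
  exists (Rmax M M'). pose proof (Rmax_l M M'). pose proof (Rmax_r M M').
  split; [lra|]. intros a b Ha Hb.
  destruct (HM a b ltac:(lra) ltac:(lra)) as [_ H1].
  destruct (HM' a b ltac:(lra) ltac:(lra)) as [_ H2].
  split; [now apply: ex_RInt_plus|].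
  rewrite (RInt_plus f g a b (Ef a b) (Eg a b)). change plus with Rplus.
  apply Rabs_def2 in H1. apply Rabs_def2 in H2. apply Rabs_def1; lra.
Qed.

Lemma improper_int_scal f v c :
  improper_int f v -> improper_int (fun t => c * f t) (c * v).
Proof.
  intros Hf. pose proof (improper_int_ex _ _ Hf) as Ef.
  apply improper_int_RInt. intros eps He.
  assert (0 < Rabs c + 1) as Hc by (pose proof (Rabs_pos c); lra).
  destruct (proj1 (improper_int_RInt f v) Hf (eps/(Rabs c + 1))) as [M [HM0 HM]].
  { now apply Rdiv_lt_0_compat. }
  exists M. split; [assumption|]. intros a b Ha Hb.
  destruct (HM a b Ha Hb) as [_ H1].
  split; [apply: (ex_RInt_scal f a b c); apply Ef|].
  rewrite (RInt_scal f a b c (Ef a b)). change scal with Rmult.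
  replace (c * RInt f a b - c * v) with (c * (RInt f a b - v)) by ring.
  rewrite Rabs_mult. pose proof (Rabs_pos c). pose proof (Rabs_pos (RInt f a b - v)).
  apply Rle_lt_trans with ((Rabs c + 1) * Rabs (RInt f a b - v)); [nra|].
  replace eps with ((Rabs c + 1) * (eps / (Rabs c + 1))) by (field; lra).
  now apply Rmult_lt_compat_l.
Qed.

Lemma improper_int_le f g v w :
  improper_int f v -> improper_int g w -> (forall t, f t <= g t) -> v <= w.
Proof.
  intros Hf Hg Hfg. apply le_epsilon. intros eps He.
  destruct (proj1 (improper_int_RInt f v) Hf (eps/2) ltac:(lra)) as [M [HM0 HM]].
  destruct (proj1 (improper_int_RInt g w) Hg (eps/2) ltac:(lra)) as [M' [HM0' HM']].
  pose proof (Rmax_l M M'). pose proof (Rmax_r M M').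
  destruct (HM (- Rmax M M') (Rmax M M') ltac:(lra) ltac:(lra)) as [E1 H1].
  destruct (HM' (- Rmax M M') (Rmax M M') ltac:(lra) ltac:(lra)) as [E2 H2].
  assert (RInt f (- Rmax M M') (Rmax M M') <= RInt g (- Rmax M M') (Rmax M M')).
  { apply RInt_le; auto; lra. }
  apply Rabs_def2 in H1. apply Rabs_def2 in H2. lra.
Qed.

(** Extensionality of [is_RInt] looks at the open interval only: cutting at each point of [L] turns
    it into an endpoint, where the values no longer matter. *)
Lemma is_RInt_ext_off_list (f g : R -> R) (L : list R) : forall a b,
  a <= b -> ex_RInt f a b -> (forall x, a < x < b -> ~ In x L -> f x = g x) ->
  is_RInt g a b (RInt f a b).
Proof.
  induction L as [|c L IH]; intros a b Hab Hf Hfg.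
  - apply is_RInt_ext with f; [|now apply: RInt_correct].
    rewrite Rmin_left // Rmax_right //. intros x Hx. apply Hfg; auto.
  - destruct (Rlt_dec a c) as [Hac|Hac]; [destruct (Rlt_dec c b) as [Hcb|Hcb]|].
    + assert (ex_RInt f a c) by (apply ex_RInt_sub with a b; auto; lra).
      assert (ex_RInt f c b) by (apply ex_RInt_sub with a b; auto; lra).
      rewrite (RInt_split f a c b); auto.
      apply is_RInt_split with c; apply IH; auto; try lra;
        intros x Hx Hn; apply Hfg; try lra; intros [E|E]; auto; lra.
    + apply IH; auto. intros x Hx Hn; apply Hfg; try lra; intros [E|E]; auto; lra.
    + apply IH; auto. intros x Hx Hn; apply Hfg; try lra; intros [E|E]; auto; lra.
Qed.

Lemma improper_int_ext_off_list f g v (L : list R) :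
  (forall x, ~ In x L -> f x = g x) -> improper_int f v -> improper_int g v.
Proof.
  intros Hfg Hf. apply improper_int_RInt. intros eps He.
  destruct (proj1 (improper_int_RInt f v) Hf eps He) as [M [HM0 HM]].
  exists M. split; [assumption|]. intros a b Ha Hb.
  destruct (HM a b Ha Hb) as [E H].
  assert (is_RInt g a b (RInt f a b)) as K.
  { apply is_RInt_ext_off_list with L; auto; lra. }
  split; [eexists; exact K|]. now rewrite (is_RInt_unique _ _ _ _ K).
Qed.

Lemma improper_int_ext f g v : (forall x, f x = g x) -> improper_int f v -> improper_int g v.
Proof. intros H. now apply improper_int_ext_off_list with nil. Qed.

(** Integrals of a nonnegative function grow with the window, so their supremum is also their
    limit. *)
Lemma improper_int_lub f v : (forall t, 0 <= f t) -> (forall a b, a <= b -> ex_RInt f a b) ->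
  is_lub (fun y => exists a b, a <= b /\ y = RInt f a b) v -> improper_int f v.
Proof.
  intros Hpos Hex [Hub Hlub]. apply improper_int_RInt. intros eps He.
  assert (exists c d, c <= d /\ v - eps < RInt f c d) as [c [d [Hcd Hv]]].
  { apply NNPP. intros Hn. assert (v <= v - eps); [|lra].
    apply Hlub. intros y [a [b [Hab ->]]]. apply Rnot_lt_le. intros Hlt.
    apply Hn. now exists a, b. }
  exists (Rmax (Rabs c) (Rabs d)).
  pose proof (Rmax_l (Rabs c) (Rabs d)). pose proof (Rmax_r (Rabs c) (Rabs d)).
  split; [pose proof (Rabs_pos c); lra|]. intros a b Ha Hb.
  assert (a <= c) by (pose proof (Rle_abs (-c)); rewrite Rabs_Ropp in H1; lra).
  assert (d <= b) by (pose proof (Rle_abs d); lra).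
  split; [apply Hex; lra|].
  assert (RInt f a b <= v) by (apply Hub; exists a, b; split; auto; lra).
  rewrite -> (RInt_split f a c b), (RInt_split f c d b) in * by (apply Hex; lra).
  assert (0 <= RInt f a c) by (apply RInt_ge_0; auto; apply Hex; lra).
  assert (0 <= RInt f d b) by (apply RInt_ge_0; auto; apply Hex; lra).
  apply Rabs_def1; lra.
Qed.

Lemma improper_int_bounded f D : (forall t, 0 <= f t) -> (forall a b, a <= b -> ex_RInt f a b) ->
  (forall a b, a <= b -> RInt f a b <= D) -> exists v, improper_int f v.
Proof.
  intros Hpos Hex HD.
  destruct (completeness (fun y => exists a b, a <= b /\ y = RInt f a b)) as [v Hv].
  - exists D. intros y [a [b [Hab ->]]]. auto.
  - exists (RInt f 0 0), 0, 0. split; auto; lra.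
  - exists v. now apply improper_int_lub.
Qed.

(** * The Gaussian distribution function and the first moments *)

Lemma sqrt_2PI_pos : 0 < sqrt (2 * PI).
Proof. apply sqrt_lt_R0. pose proof PI_RGT_0. lra. Qed.

Lemma gauss_density_pos t : 0 < gauss_density t.
Proof. unfold gauss_density. apply Rdiv_lt_0_compat; [apply exp_pos|apply sqrt_2PI_pos]. Qed.

Lemma is_derive_gauss_density t : is_derive gauss_density t (- t * gauss_density t).
Proof.
  unfold gauss_density. auto_derive; [trivial|]. pose proof sqrt_2PI_pos. simpl. unfold Rdiv. field. lra.
Qed.

Lemma continuous_gauss_density t : continuous gauss_density t.
Proof. apply: ex_derive_continuous. eexists. apply is_derive_gauss_density. Qed.

Lemma ex_RInt_gauss a b : ex_RInt gauss_density a b.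
Proof. apply: ex_RInt_continuous. intros z _. apply continuous_gauss_density. Qed.

(** Based at 0 instead of minus infinity: it needs no improper integral, is odd, and tends to 1/2
    and -1/2. *)
Definition Phi (x : R) : R := RInt gauss_density 0 x.

Lemma is_derive_Phi x : is_derive Phi x (gauss_density x).
Proof.
  apply: (is_derive_RInt gauss_density Phi 0 x); [|apply continuous_gauss_density].
  apply filter_forall. intros y. apply: RInt_correct. apply ex_RInt_gauss.
Qed.

Lemma RInt_gauss a b : (RInt gauss_density a b : R) = Phi b - Phi a.
Proof.
  pose proof (RInt_split gauss_density 0 a b (ex_RInt_gauss _ _) (ex_RInt_gauss _ _)).
  unfold Phi. lra.
Qed.

Lemma Phi_0 : Phi 0 = 0.
Proof. exact (RInt_point 0 gauss_density). Qed.

Lemma Phi_le x y : x <= y -> Phi x <= Phi y.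
Proof.
  intros H. pose proof (RInt_gauss x y).
  assert (0 <= RInt gauss_density x y); [|lra].
  apply RInt_ge_0; auto; [apply ex_RInt_gauss|]. intros; left; apply gauss_density_pos.
Qed.

Lemma Phi_opp x : Phi (- x) = - Phi x.
Proof.
  assert (is_RInt (fun y => scal (-1) (gauss_density (-1 * y + 0))) 0 x (Phi (- x))) as H.
  { apply: is_RInt_comp_lin. replace (-1 * 0 + 0) with 0 by ring.
    replace (-1 * x + 0) with (- x) by ring. apply: RInt_correct. apply ex_RInt_gauss. }
  assert (is_RInt (fun y => scal (-1) (gauss_density y)) 0 x (scal (-1) (Phi x))) as K.
  { apply: is_RInt_scal. apply: RInt_correct. apply ex_RInt_gauss. }
  rewrite <- (is_RInt_unique _ _ _ _ H).
  replace (- Phi x) with (scal (-1) (Phi x)) by (unfold scal; simpl; unfold mult; simpl; lra).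
  apply is_RInt_unique. apply: is_RInt_ext K. intros y _. unfold gauss_density.
  do 5 f_equal. ring.
Qed.

(** The auxiliary integrand of the classical evaluation of the Gaussian integral by differentiation
    under the integral sign: its integral over t in [0, 1], added to [Phi x ^ 2], is constant in x.
    The division by [PI] makes the constant 1/4. *)
Definition gauss_aux (x t : R) : R := exp (- (x ^ 2 * (1 + t ^ 2)) / 2) / (1 + t ^ 2) / PI.

Lemma is_derive_gauss_aux (x t : R) :
  is_derive (fun u => gauss_aux u t) x (- x * exp (- (x ^ 2 * (1 + t ^ 2)) / 2) / PI).
Proof.
  unfold gauss_aux. pose proof PI_RGT_0. assert (0 < 1 + t ^ 2) by nra.
  auto_derive; [simpl in *; lra|]. simpl in *. unfold Rdiv. field. lra.
Qed.

Lemma continuous_gauss_aux x t : continuous (gauss_aux x) t.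
Proof.
  apply: ex_derive_continuous. unfold gauss_aux. pose proof PI_RGT_0.
  assert (0 < 1 + t ^ 2) by nra. auto_derive. simpl in *. lra.
Qed.

(** The exponential splits as exp(-x^2/2) exp(-(x t)^2/2), and the substitution u = x t turns the
    second factor into [Phi x]. *)
Lemma RInt_gauss_aux_derive (x : R) :
  is_derive (fun u => RInt (gauss_aux u) 0 1) x (- 2 * Phi x * gauss_density x).
Proof.
  assert (forall u t, Derive (fun u => gauss_aux u t) u
    = - u * exp (- (u ^ 2 * (1 + t ^ 2)) / 2) / PI) as HD.
  { intros u t. apply is_derive_unique, is_derive_gauss_aux. }
  replace (- 2 * Phi x * gauss_density x) with
    (RInt (fun t => Derive (fun u => gauss_aux u t) x) 0 1).
  - apply is_derive_RInt_param.
    + apply filter_forall. intros u t _. eexists. apply is_derive_gauss_aux.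
    + intros t _.
      apply continuity_2d_pt_ext with (fun u v => - u * exp (- (u ^ 2 * (1 + v ^ 2)) / 2) / PI).
      { intros u v. now rewrite HD. }
      apply continuity_2d_pt_mult; [|apply continuity_2d_pt_const].
      apply continuity_2d_pt_mult; [apply continuity_2d_pt_opp, continuity_2d_pt_id1|].
      apply continuity_1d_2d_pt_comp with (f := exp).
      { apply derivable_continuous_pt, derivable_pt_exp. }
      apply continuity_2d_pt_mult; [|apply continuity_2d_pt_const].
      apply continuity_2d_pt_opp. simpl.
      repeat first [apply continuity_2d_pt_mult|apply continuity_2d_pt_plus|
        apply continuity_2d_pt_const|apply continuity_2d_pt_id1|apply continuity_2d_pt_id2].
    + apply filter_forall. intros u. apply: ex_RInt_continuous. intros t _.
      apply continuous_gauss_aux.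
  - pose proof PI_RGT_0. pose proof sqrt_2PI_pos.
    assert (is_RInt (fun y => scal x (gauss_density (x * y + 0))) 0 1 (Phi x)) as H1.
    { apply: is_RInt_comp_lin. replace (x * 0 + 0) with 0 by ring.
      replace (x * 1 + 0) with x by (simpl; lra). apply: RInt_correct. apply ex_RInt_gauss. }
    apply is_RInt_unique.
    pose proof (is_RInt_scal (V := R_NormedModule) _ 0 1 (- 2 * gauss_density x) _ H1) as H2.
    replace (- 2 * Phi x * gauss_density x) with (scal (- 2 * gauss_density x) (Phi x))
      by (unfold scal; simpl; unfold mult; simpl; lra).
    apply: is_RInt_ext H2. intros t _. rewrite HD. unfold gauss_density.
    replace (exp (- (x ^ 2 * (1 + t ^ 2)) / 2)) with (exp (- x ^ 2 / 2) * exp (- (x * t + 0) ^ 2 / 2))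
      by (rewrite <- exp_plus; f_equal; field).
    set E1 := exp _. set E2 := exp _. unfold scal; simpl; unfold mult; simpl.
    transitivity (- 2 * x * E1 * E2 / (sqrt (2 * PI) * sqrt (2 * PI))); [field; lra|].
    rewrite sqrt_sqrt; [field|]; lra.
Qed.

Lemma Phi_sqr x : Phi x ^ 2 = / 4 - RInt (gauss_aux x) 0 1.
Proof.
  assert (forall y, is_derive (fun u => Phi u ^ 2 + RInt (gauss_aux u) 0 1) y 0) as H.
  { intros y.
    assert (is_derive (fun u => Phi u ^ 2) y (INR 2 * gauss_density y * Phi y ^ 1)) as K.
    { apply (is_derive_pow Phi 2 y), is_derive_Phi. }
    pose proof (is_derive_plus _ _ _ _ _ K (RInt_gauss_aux_derive y)) as K2.
    match type of K2 with is_derive _ _ ?l => replace l with 0 in K2 end; [exact K2|].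
    unfold plus; simpl. lra. }
  assert (Phi x ^ 2 + RInt (gauss_aux x) 0 1 = Phi 0 ^ 2 + RInt (gauss_aux 0) 0 1) as E.
  { destruct (MVT_gen (fun u => Phi u ^ 2 + RInt (gauss_aux u) 0 1) 0 x (fun _ => 0)) as [c [_ Hc]].
    - intros; apply H.
    - intros y _. apply derivable_continuous_pt. exists 0. now apply is_derive_Reals.
    - lra. }
  rewrite Phi_0 in E.
  assert (RInt (gauss_aux 0) 0 1 = / 4); [|lra].
  pose proof PI_RGT_0.
  apply is_RInt_unique. replace (/ 4) with (atan 1 / PI - atan 0 / PI)
    by (rewrite atan_1 atan_0; field; lra).
  apply (is_RInt_FTC (fun t => atan t / PI)); [lra| |].
  - intros t _. unfold gauss_aux.
    replace (- (0 ^ 2 * (1 + t ^ 2)) / 2) with 0 by field. rewrite exp_0.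
    auto_derive; [trivial|]. unfold Rsqr. field. split; nra.
  - intros t _. apply continuous_gauss_aux.
Qed.

(** Write E for the exponential. The auxiliary integral lies between 0 and E / 2. If 0 <= [Phi x] <
    1/2 - E, then [Phi x ^ 2] < (1/2) (1/2 - E) = 1/4 - E / 2, against [Phi_sqr]. *)
Lemma Phi_bounds x : 0 <= x -> / 2 - exp (- x ^ 2 / 2) <= Phi x <= / 2.
Proof.
  intros Hx. pose proof (Phi_sqr x) as E. pose proof (Phi_le 0 x Hx) as P. rewrite Phi_0 in P.
  assert (ex_RInt (gauss_aux x) 0 1) as EX.
  { apply: ex_RInt_continuous. intros t _. apply continuous_gauss_aux. }
  pose proof PI_RGT_0. pose proof (exp_pos (- x ^ 2 / 2)) as P1.
  assert (forall t, 0 < gauss_aux x t <= exp (- x ^ 2 / 2) * / 2) as B.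
  { intros t. unfold gauss_aux. assert (1 <= 1 + t ^ 2) by nra.
    pose proof (exp_pos (- (x ^ 2 * (1 + t ^ 2)) / 2)).
    split; [repeat apply Rdiv_lt_0_compat; lra|].
    assert (exp (- (x ^ 2 * (1 + t ^ 2)) / 2) <= exp (- x ^ 2 / 2)).
    { destruct (Req_dec (- (x ^ 2 * (1 + t ^ 2)) / 2) (- x ^ 2 / 2)) as [->|]; [lra|].
      left; apply exp_increasing. nra. }
    pose proof PI2_3_2. unfold PI2 in *.
    apply Rle_trans with (exp (- x ^ 2 / 2) / (1 + t ^ 2) / PI).
    { unfold Rdiv. repeat apply Rmult_le_compat_r; auto; left; apply Rinv_0_lt_compat; lra. }
    unfold Rdiv. rewrite Rmult_assoc. apply Rmult_le_compat_l; [lra|].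
    rewrite <- Rinv_mult. apply Rinv_le_contravar; nra. }
  assert (0 <= RInt (gauss_aux x) 0 1).
  { apply RInt_ge_0; auto; [lra|]. intros t _. specialize (B t). lra. }
  assert (RInt (gauss_aux x) 0 1 <= exp (- x ^ 2 / 2) * / 2).
  { apply Rle_trans with (RInt (fun _ => exp (- x ^ 2 / 2) * / 2) 0 1).
    - apply RInt_le; auto; [lra|apply ex_RInt_const|]. intros t _. apply B.
    - rewrite RInt_const. change scal with Rmult. simpl. lra. }
  split; nra.
Qed.

(** The rate C / x makes the cutoff explicit; the primitives used for the moments of order 0, 1 and
    2 all converge at this speed. *)
Lemma improper_int_FTC F f l r C : (forall x, is_derive F x (f x)) ->
  (forall x, continuous f x) ->
  (forall x, 1 <= x -> Rabs (F x - r) <= C / x /\ Rabs (F (- x) - l) <= C / x) ->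
  improper_int f (r - l).
Proof.
  intros HF Hf HC. apply improper_int_RInt. intros eps He.
  assert (0 <= C).
  { destruct (HC 1 ltac:(lra)) as [H _]. pose proof (Rabs_pos (F 1 - r)). lra. }
  assert (0 <= 2 * C / eps) by (apply Rdiv_le_0_compat; lra).
  exists (2 * C / eps + 1). split; [lra|]. intros a b Ha Hb.
  pose proof (is_RInt_FTC F f a b ltac:(lra) ltac:(auto) ltac:(auto)) as HI.
  split; [eexists; exact HI|]. rewrite (is_RInt_unique _ _ _ _ HI).
  assert (forall x, 2 * C / eps + 1 <= x -> C / x < eps / 2) as K.
  { intros x Hx. apply Rmult_lt_reg_r with x; [lra|].
    replace (C / x * x) with C by (field; lra).
    replace C with (eps / 2 * (2 * C / eps)) at 1 by (field; lra).
    apply Rmult_lt_compat_l; lra. }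
  destruct (HC b ltac:(lra)) as [H1 _]. destruct (HC (- a) ltac:(lra)) as [_ H2].
  rewrite Ropp_involutive in H2.
  pose proof (K b ltac:(lra)). pose proof (K (- a) ltac:(lra)).
  assert (Rabs (F b - r) < eps / 2) as B1 by lra. assert (Rabs (F a - l) < eps / 2) as B2 by lra.
  apply Rabs_def2 in B1. apply Rabs_def2 in B2. apply Rabs_def1; lra.
Qed.

Lemma exp_neg_sqr_le x : 1 <= x -> exp (- x ^ 2 / 2) * x <= 2 / x.
Proof.
  intros Hx. pose proof (exp_ineq1_le (x ^ 2 / 2)).
  replace (- x ^ 2 / 2) with (- (x ^ 2 / 2)) by field. rewrite exp_Ropp.
  assert (0 < x ^ 2) by nra. pose proof (exp_pos (x ^ 2 / 2)).
  apply Rmult_le_reg_r with (exp (x ^ 2 / 2) * x); [nra|].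
  replace (/ exp (x ^ 2 / 2) * x * (exp (x ^ 2 / 2) * x)) with (x ^ 2) by (field; lra).
  replace (2 / x * (exp (x ^ 2 / 2) * x)) with (2 * exp (x ^ 2 / 2)) by (field; lra). lra.
Qed.

Lemma sqrt_2PI_ge : 2 <= sqrt (2 * PI).
Proof.
  pose proof PI2_3_2. unfold PI2 in *.
  rewrite <- (sqrt_square 2) at 1; [|lra]. apply sqrt_le_1; lra.
Qed.

Lemma gauss_density_le x : gauss_density x <= exp (- x ^ 2 / 2).
Proof.
  unfold gauss_density. pose proof sqrt_2PI_ge. pose proof (exp_pos (- x ^ 2 / 2)).
  apply Rmult_le_reg_r with (sqrt (2 * PI)); [lra|]. unfold Rdiv at 1.
  rewrite Rmult_assoc Rinv_l; [|lra]. nra.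
Qed.

Lemma gauss_density_le_1 x : gauss_density x <= 1.
Proof.
  apply Rle_trans with (1 := gauss_density_le x). rewrite <- exp_0.
  destruct (Req_dec (x ^ 2) 0) as [E|E].
  - rewrite E. right. f_equal. field.
  - left. apply exp_increasing. nra.
Qed.

Lemma gauss_density_opp x : gauss_density (- x) = gauss_density x.
Proof. unfold gauss_density. do 4 f_equal. ring. Qed.

Lemma gauss_density_mul_le x : 1 <= x -> gauss_density x * x <= 2 / x.
Proof.
  intros H. apply Rle_trans with (2 := exp_neg_sqr_le x H).
  apply Rmult_le_compat_r; [lra|apply gauss_density_le].
Qed.

Lemma Phi_tail x : 1 <= x -> / 2 - 2 / x <= Phi x <= / 2.
Proof.
  intros H. pose proof (Phi_bounds x ltac:(lra)). pose proof (exp_neg_sqr_le x H).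
  pose proof (exp_pos (- x ^ 2 / 2)). nra.
Qed.

Lemma improper_int_gauss : improper_int gauss_density 1.
Proof.
  replace 1 with (/ 2 - - / 2) by field.
  apply (improper_int_FTC Phi _ _ _ 2); [apply is_derive_Phi|apply continuous_gauss_density|].
  intros x Hx. rewrite Phi_opp. pose proof (Phi_tail x Hx).
  split; apply Rabs_le; lra.
Qed.

Lemma improper_int_gauss1 : improper_int (fun t => t * gauss_density t) 0.
Proof.
  replace 0 with (0 - 0) by ring.
  apply (improper_int_FTC (fun t => - gauss_density t) _ _ _ 2).
  - intros x. pose proof (is_derive_opp _ _ _ (is_derive_gauss_density x)) as H.
    match type of H with is_derive _ _ ?l => replace l with (x * gauss_density x) in H end; [exact H|].
    unfold opp; simpl. ring.
  - intros x. apply: ex_derive_continuous. eexists.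
    apply: is_derive_mult; [apply: is_derive_id|apply is_derive_gauss_density|apply Rmult_comm].
  - intros x Hx. rewrite gauss_density_opp. pose proof (gauss_density_mul_le x Hx).
    pose proof (gauss_density_pos x). split; apply Rabs_le; nra.
Qed.

Lemma improper_int_gauss2 : improper_int (fun t => t ^ 2 * gauss_density t) 1.
Proof.
  replace 1 with (/ 2 - - / 2) by field.
  assert (forall x, is_derive (fun t => t * gauss_density t) x (gauss_density x - x ^ 2 * gauss_density x)) as D.
  { intros x. unfold gauss_density. pose proof sqrt_2PI_pos. auto_derive; [trivial|].
    simpl. unfold Rdiv. field. lra. }
  apply (improper_int_FTC (fun t => Phi t - t * gauss_density t) _ _ _ 4).
  - intros x. pose proof (is_derive_minus _ _ _ _ _ (is_derive_Phi x) (D x)) as H.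
    match type of H with is_derive _ _ ?l => replace l with (x ^ 2 * gauss_density x) in H end; [exact H|].
    unfold minus, plus, opp; simpl. ring.
  - intros x. apply: ex_derive_continuous. unfold gauss_density. auto_derive. trivial.
  - intros x Hx. rewrite gauss_density_opp Phi_opp. pose proof (gauss_density_mul_le x Hx).
    pose proof (gauss_density_pos x). pose proof (Phi_tail x Hx).
    assert (0 <= x * gauss_density x) by nra.
    split; apply Rabs_le; lra.
Qed.

Lemma improper_int_comp_lin f v k q : 0 < k -> improper_int f v ->
  improper_int (fun t => f (k * t + q)) (v / k).
Proof.
  intros Hk Hf. pose proof (improper_int_ex _ _ Hf) as Ef.
  assert (improper_int (fun t => k * f (k * t + q)) v) as H.
  { apply improper_int_RInt. intros eps He.
    destruct (proj1 (improper_int_RInt f v) Hf eps He) as [M [HM0 HM]].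
    exists ((M + Rabs q) / k).
    assert (0 <= Rabs q) by apply Rabs_pos.
    split; [apply Rdiv_le_0_compat; lra|]. intros a b Ha Hb.
    assert (k * a + q <= - M).
    { apply Rmult_le_compat_l with (r := k) in Ha; [|lra].
      replace (k * - ((M + Rabs q) / k)) with (- M - Rabs q) in Ha by (field; lra).
      pose proof (Rle_abs q). lra. }
    assert (M <= k * b + q).
    { apply Rmult_le_compat_l with (r := k) in Hb; [|lra].
      replace (k * ((M + Rabs q) / k)) with (M + Rabs q) in Hb by (field; lra).
      pose proof (Rle_abs (- q)). rewrite Rabs_Ropp in H1. lra. }
    destruct (HM _ _ H0 H1) as [_ H2].
    assert (is_RInt (fun y => k * f (k * y + q)) a b (RInt f (k * a + q) (k * b + q))) as H3.
    { apply: (is_RInt_comp_lin f k q a b). apply: RInt_correct. apply Ef. }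
    split; [eexists; exact H3|]. now rewrite (is_RInt_unique _ _ _ _ H3). }
  apply (improper_int_scal _ _ (/ k)) in H.
  replace (v / k) with (/ k * v) by (field; lra).
  apply improper_int_ext with (2 := H). intros t. field. lra.
Qed.

(** When k (t + q) is standard normal, b + beta t has mean b - beta q and variance beta^2 / k^2; the
    outer division by k is the Jacobian. This is the one-variable step of [gauss_exp_tilted]. *)
Lemma improper_int_quadratic_gauss A b beta k q : 0 < k ->
  improper_int (fun t => (A + (b + beta * t) ^ 2) * gauss_density (k * (t + q)))
    ((A + (b - beta * q) ^ 2 + beta ^ 2 / k ^ 2) / k).
Proof.
  intros Hk. set (b' := b - beta * q). set (B := beta / k).
  pose proof (improper_int_scal _ _ (A + b' ^ 2) improper_int_gauss) as H0.
  pose proof (improper_int_scal _ _ (2 * b' * B) improper_int_gauss1) as H1.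
  pose proof (improper_int_scal _ _ (B ^ 2) improper_int_gauss2) as H2.
  pose proof (improper_int_plus _ _ _ _ (improper_int_plus _ _ _ _ H0 H1) H2) as H.
  apply (improper_int_comp_lin _ _ k (k * q) Hk) in H.
  match type of H with improper_int _ ?l =>
    replace ((A + b' ^ 2 + beta ^ 2 / k ^ 2) / k) with l by (unfold B; field; lra) end.
  apply improper_int_ext with (2 := H). intros t. cbv beta.
  replace (k * t + k * q) with (k * (t + q)) by ring.
  replace (b + beta * t) with (b' + B * (k * (t + q))) by (unfold b', B; field; lra). ring.
Qed.

(** * Gaussian mass of an interval given only as a convex set *)

Definition indic (J : R -> Prop) (t : R) : R :=
  if excluded_middle_informative (J t) then 1 else 0.

Lemma indic_in J t : J t -> indic J t = 1.
Proof. unfold indic. now destruct excluded_middle_informative. Qed.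

Lemma indic_out J t : ~ J t -> indic J t = 0.
Proof. unfold indic. now destruct excluded_middle_informative. Qed.

Lemma indic_bounds J t : 0 <= indic J t <= 1.
Proof. unfold indic. destruct excluded_middle_informative; lra. Qed.

Lemma Phi_lip x y : x <= y -> Phi y - Phi x <= y - x.
Proof.
  intros H. rewrite <- RInt_gauss.
  replace (y - x) with (RInt (fun _ => 1) x y)
    by (rewrite RInt_const; unfold scal; simpl; unfold mult; simpl; lra).
  apply RInt_le; auto; [apply ex_RInt_gauss|apply ex_RInt_const|].
  intros t _. apply gauss_density_le_1.
Qed.

Lemma is_RInt_zero (f : R -> R) a b : a <= b -> (forall x, a < x < b -> f x = 0) -> is_RInt f a b 0.
Proof.
  intros Hab H. assert (is_RInt (fun _ => 0) a b 0) as K.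
  { pose proof (is_RInt_const (V := R_NormedModule) a b 0) as K.
    unfold scal in K; simpl in K; unfold mult in K; simpl in K.
    rewrite Rmult_0_r in K. exact K. }
  apply: is_RInt_ext K. rewrite Rmin_left // Rmax_right //. intros x Hx. now rewrite H.
Qed.

(** [J] may be open, closed or unbounded on either side. In each window only its infimum c and
    supremum d there count; [Phi] being 1-Lipschitz, they can be approached by points of [J] at
    arbitrarily small cost. *)
Lemma improper_int_indic (J : R -> Prop) V :
  (forall x y z, J x -> J z -> x <= y <= z -> J y) -> (exists x, J x) ->
  is_lub (fun y => exists u v, J u /\ J v /\ u <= v /\ y = Phi v - Phi u) V ->
  improper_int (fun t => indic J t * gauss_density t) V.
Proof.
  intros Hconv [x0 Hx0] [Hub Hlub].
  assert (0 <= V) as HV by (apply Hub; exists x0, x0; repeat split; auto; lra).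
  assert (forall a b, a <= b -> exists l, l <= V /\ is_RInt (fun t => indic J t * gauss_density t) a b l) as K.
  { intros a b Hab.
    destruct (classic (exists j, a <= j <= b /\ J j)) as [[j0 [Hj0 Jj0]]|Hn].
    2:{ exists 0. split; [assumption|]. apply is_RInt_zero; auto. intros x Hx.
        rewrite indic_out; [ring|]. intros Jx. apply Hn. exists x. split; auto; lra. }
    destruct (completeness (fun x => a <= x <= b /\ J x)) as [d [Hd1 Hd2]].
    { exists b. intros x Hx. lra. }
    { now exists j0. }
    (* [completeness] yields suprema only, so the infimum c is taken as the supremum of the lower
       bounds. *)
    destruct (completeness (fun x => a <= x <= b /\ forall j, a <= j <= b -> J j -> x <= j)) as [c [Hc1 Hc2]].
    { exists b. intros x Hx. lra. }
    { exists a. split; [lra|]. intros; lra. }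
    assert (a <= c) by (apply Hc1; split; [lra|intros; lra]).
    assert (c <= d).
    { apply Hc2. intros x [_ Hx]. apply Rle_trans with j0; auto. }
    assert (d <= b) by (apply Hd2; intros x Hx; lra).
    exists (Phi d - Phi c). split.
    - apply le_epsilon. intros eps He.
      assert (exists u, a <= u <= b /\ J u /\ u < c + eps / 2) as [u [Hu [Ju Huc]]].
      { apply NNPP. intros Hn.
        assert (forall j, a <= j <= b -> J j -> c + eps / 2 <= j) as Hlb.
        { intros j Hj Jj. apply Rnot_lt_le. intros Hlt. apply Hn. now exists j. }
        pose proof (Hlb j0 Hj0 Jj0).
        assert (c + eps / 2 <= c); [|lra]. apply Hc1. split; auto; lra. }
      assert (exists v, a <= v <= b /\ J v /\ d - eps / 2 < v) as [v [Hv [Jv Hvd]]].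
      { apply NNPP. intros Hn. assert (d <= d - eps / 2); [|lra]. apply Hd2.
        intros j [Hj Jj]. apply Rnot_lt_le. intros Hlt. apply Hn. now exists j. }
      assert (c <= u) by (apply Hc2; intros x [_ Hx]; auto).
      assert (v <= d) by (apply Hd1; auto).
      destruct (Rle_dec u v) as [Huv|Huv].
      + assert (Phi v - Phi u <= V) by (apply Hub; exists u, v; auto).
        pose proof (Phi_lip c u). pose proof (Phi_lip v d). lra.
      (* Here v < u, hence d - c < eps, and the Lipschitz bound alone suffices. *)
      + pose proof (Phi_lip c d). lra.
    - replace (Phi d - Phi c) with (0 + (Phi d - Phi c) + 0) by ring.
      apply is_RInt_split with d; [apply is_RInt_split with c|].
      + apply is_RInt_zero; auto. intros x Hx. rewrite indic_out; [ring|]. intros Jx.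
        assert (c <= x); [|lra]. apply Hc2. intros y [_ Hy]. apply Hy; auto; lra.
      + rewrite <- RInt_gauss. apply is_RInt_ext_off_list with nil; auto; [apply ex_RInt_gauss|].
        intros x Hx _. rewrite indic_in; [ring|].
        assert (exists u, a <= u <= b /\ J u /\ u <= x) as [u [_ [Ju Hux]]].
        { apply NNPP. intros Hn. assert (x <= c); [|lra]. apply Hc1. split; [lra|].
          intros j Hj Jj. apply Rnot_lt_le. intros Hlt. apply Hn. exists j. repeat split; auto; lra. }
        assert (exists v, a <= v <= b /\ J v /\ x <= v) as [v [_ [Jv Hvx]]].
        { apply NNPP. intros Hn. assert (d <= x); [|lra]. apply Hd2.
          intros j [Hj Jj]. apply Rnot_lt_le. intros Hlt. apply Hn. exists j. repeat split; auto; lra. }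
        apply Hconv with u v; auto.
      + apply is_RInt_zero; auto. intros x Hx. rewrite indic_out; [ring|]. intros Jx.
        assert (x <= d); [|lra]. apply Hd1. split; auto; lra. }
  apply improper_int_lub.
  - intros t. apply Rmult_le_pos; [apply indic_bounds|left; apply gauss_density_pos].
  - intros a b Hab. destruct (K a b Hab) as [l [_ Hl]]. now exists l.
  - split.
    + intros y [a [b [Hab ->]]]. destruct (K a b Hab) as [l [H1 Hl]].
      now rewrite (is_RInt_unique _ _ _ _ Hl).
    + intros w Hw. apply Hlub. intros y [u [v [Ju [Jv [Huv ->]]]]].
      apply Hw. exists u, v. split; auto.
      assert (is_RInt (fun t => indic J t * gauss_density t) u v (RInt gauss_density u v)) as E.
      { apply is_RInt_ext_off_list with nil; auto; [apply ex_RInt_gauss|].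
        intros x Hx _. rewrite indic_in; [ring|]. apply Hconv with u v; auto; lra. }
      rewrite (is_RInt_unique _ _ _ _ E). now rewrite RInt_gauss.
Qed.

(** * A sandwich criterion for Riemann integrability *)

Lemma ex_RInt_stepfun a b (phi : StepFun a b) :
  ex_RInt phi a b /\ (RInt phi a b : R) = RiemannInt_SF phi.
Proof.
  assert (forall eps : posreal, (forall t, Rmin a b <= t <= Rmax a b ->
    Rabs (phi t - phi t) <= fct_cte 0 t) /\
    Rabs (RiemannInt_SF (mkStepFun (StepFun_P4 a b 0))) < eps) as K.
  { intros eps. split.
    - intros t _. rewrite Rminus_diag Rabs_R0. unfold fct_cte. lra.
    - rewrite StepFun_P18 Rmult_0_l Rabs_R0. apply cond_pos. }
  (* This certificate is an explicit term with [phi] as its own approximant and error 0, so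
     [phi_sequence] computes to the constant sequence [phi]. *)
  set (pr := (fun eps => existT _ phi (exist _ (mkStepFun (StepFun_P4 a b 0)) (K eps)))
    : Riemann_integrable phi a b).
  split; [now apply ex_RInt_Reals_1|].
  rewrite (RInt_Reals phi a b pr). unfold RiemannInt.
  destruct (RiemannInt_exists pr RinvN RinvN_cv) as [l Hl].
  apply (UL_sequence _ _ _ Hl). intros eps He. exists 0%nat. intros n _.
  unfold phi_sequence; simpl. now rewrite R_dist_eq.
Qed.

Lemma ex_RInt_sandwich (f : R -> R) a b : a <= b ->
  (forall eps, 0 < eps -> exists g p, ex_RInt g a b /\ ex_RInt p a b /\
    (forall x, a <= x <= b -> Rabs (f x - g x) <= p x) /\ RInt p a b < eps) ->
  ex_RInt f a b.
Proof.
  intros Hab H. apply ex_RInt_Reals_1. intros eps.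
  assert (exists phi : StepFun a b, exists psi : StepFun a b,
    (forall t, Rmin a b <= t <= Rmax a b -> Rabs (f t - phi t) <= psi t) /\
    Rabs (RiemannInt_SF psi) < eps) as K.
  { rewrite Rmin_left // Rmax_right //.
    (* The error function will be psi1 + phi2 + psi2. Since phi2 <= p + psi2, its integral stays
       below four quarters of eps: one from psi1, one from p and two from psi2. *)
    destruct (H (eps / 4)) as [g [p [Hg [Hp [Hfg Hpe]]]]].
    { pose proof (cond_pos eps). lra. }
    assert (0 < eps / 4) as He4 by (pose proof (cond_pos eps); lra).
    destruct (ex_RInt_Reals_0 _ _ _ Hg (mkposreal _ He4)) as [phi1 [psi1 [H1 H1']]].
    destruct (ex_RInt_Reals_0 _ _ _ Hp (mkposreal _ He4)) as [phi2 [psi2 [H2 H2']]].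
    rewrite Rmin_left // Rmax_right // in H1 H2. simpl in H1', H2'.
    pose (S2 := mkStepFun (StepFun_P28 1 phi2 psi2)).
    pose (S := mkStepFun (StepFun_P28 1 psi1 S2)).
    exists phi1, S.
    assert (forall t, a <= t <= b -> Rabs (f t - phi1 t) <= S t) as HS.
    { intros t Ht. simpl. specialize (H1 t Ht). specialize (H2 t Ht). specialize (Hfg t Ht).
      replace (f t - phi1 t) with ((f t - g t) + (g t - phi1 t)) by ring.
      pose proof (Rabs_triang (f t - g t) (g t - phi1 t)).
      pose proof (Rle_abs (p t - phi2 t)). lra. }
    split; [exact HS|].
    assert (RiemannInt_SF S = RiemannInt_SF psi1 + 1 * (RiemannInt_SF phi2 + 1 * RiemannInt_SF psi2)) as E.
    { unfold S, S2. now rewrite !StepFun_P30. }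
    destruct (ex_RInt_stepfun _ _ phi2) as [E2 E2'].
    destruct (ex_RInt_stepfun _ _ psi2) as [E3 E3'].
    destruct (ex_RInt_stepfun _ _ S) as [E4 E4'].
    assert (0 <= RInt S a b).
    { apply RInt_ge_0; auto. intros x Hx. apply Rle_trans with (2 := HS x ltac:(lra)). apply Rabs_pos. }
    assert (RInt phi2 a b <= RInt (fun t => p t + psi2 t) a b).
    { apply RInt_le; auto; [now apply: ex_RInt_plus|]. intros x Hx.
      specialize (H2 x ltac:(lra)). rewrite Rabs_minus_sym in H2.
      pose proof (Rle_abs (phi2 x - p x)). lra. }
    pose proof (RInt_plus (V := R_CompleteNormedModule) p psi2 a b Hp E3) as E5.
    unfold plus in E5; simpl in E5. rewrite E5 in H3.
    apply Rabs_def2 in H1'. apply Rabs_def2 in H2'. apply Rabs_def1; lra. }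
  destruct (constructive_indefinite_description _ K) as [phi K1].
  destruct (constructive_indefinite_description _ K1) as [psi K2].
  exists phi, psi. exact K2.
Qed.

(** Covers the one jump allowed to an inner expectation, where its variable crosses 0: the function
    is replaced by 0 on (-d, d), at a cost of at most 2 D d. *)
Lemma ex_RInt_bounded_off_0 (g : R -> R) D a b : a <= b -> (forall t, 0 <= g t <= D) ->
  (forall t, t <> 0 -> continuous g t) -> ex_RInt g a b.
Proof.
  intros Hab HD Hc. assert (0 <= D) as D0 by (specialize (HD 0); lra).
  (* The window is enlarged to contain [-1, 1], so that (-d, d) lies inside it whatever the position
     of 0 relative to [a, b]. *)
  pose (A := Rmin a (-1)). pose (B := Rmax b 1).
  assert (A <= a) by apply Rmin_l. assert (A <= -1) by apply Rmin_r.
  assert (b <= B) by apply Rmax_l. assert (1 <= B) by apply Rmax_r.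
  apply ex_RInt_sub with A B; auto. apply ex_RInt_sandwich; [lra|]. intros eps He.
  pose (d := Rmin (/ 2) (eps / (2 * (2 * D + 1)))).
  assert (0 < eps / (2 * (2 * D + 1))) by (apply Rdiv_lt_0_compat; lra).
  assert (0 < d) by (apply Rmin_pos; lra). assert (d <= / 2) by apply Rmin_l.
  assert (d <= eps / (2 * (2 * D + 1))) as Hd by apply Rmin_r.
  exists (fun t => if Rlt_dec (Rabs t) d then 0 else g t), (fun t => if Rlt_dec (Rabs t) d then D else 0).
  assert (forall x y, x <= y -> (forall t, x <= t <= y -> t <> 0) -> ex_RInt g x y) as Eg.
  { intros x y Hxy Hn. apply: ex_RInt_continuous. rewrite Rmin_left // Rmax_right //.
    intros t Ht. apply Hc; auto. }
  assert (forall t, d < Rabs t -> ~ Rabs t < d) by (intros; lra).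
  assert (forall t, d <= t \/ t <= -d -> ~ Rabs t < d) as Hout.
  { intros t Ht Hlt. apply Rabs_def2 in Hlt. lra. }
  assert (forall t, -d < t < d -> Rabs t < d) as Hin by (intros; apply Rabs_def1; lra).
  repeat split.
  - assert (forall x y, x <= y -> (d <= x \/ y <= - d) ->
      ex_RInt (fun t => if Rlt_dec (Rabs t) d then 0 else g t) x y) as P.
    { intros x y Hxy Hd'. eexists. apply (is_RInt_ext_off_list g _ nil); auto.
      - apply Eg; auto. intros t Ht; lra.
      - intros t Ht _. destruct Rlt_dec as [Hl|]; auto. exfalso; apply (Hout t); auto; lra. }
    apply: (ex_RInt_Chasles _ _ (-d)); [apply P; lra|].
    apply: (ex_RInt_Chasles _ _ d); [|apply P; lra].
    exists 0. apply is_RInt_zero; [lra|]. intros x Hx. destruct Rlt_dec; auto. exfalso; apply n, Hin; lra.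
  - eexists. apply is_RInt_split with (- d); [|apply is_RInt_split with d].
    + apply is_RInt_zero; [lra|]. intros x Hx. destruct Rlt_dec; auto. exfalso; apply (Hout x); auto; lra.
    + apply (is_RInt_ext_off_list (fun _ => D) _ nil); [lra|apply ex_RInt_const|].
      intros x Hx _. destruct Rlt_dec; auto. exfalso; apply n, Hin; lra.
    + apply is_RInt_zero; [lra|]. intros x Hx. destruct Rlt_dec; auto. exfalso; apply (Hout x); auto; lra.
  - intros x Hx. specialize (HD x). destruct Rlt_dec; apply Rabs_le; lra.
  - assert (is_RInt (fun t => if Rlt_dec (Rabs t) d then D else 0) A B (0 + (RInt (fun _ => D) (- d) d + 0))) as E.
    { apply is_RInt_split with (- d); [|apply is_RInt_split with d].
      + apply is_RInt_zero; [lra|]. intros x Hx. destruct Rlt_dec; auto. exfalso; apply (Hout x); auto; lra.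
      + apply (is_RInt_ext_off_list (fun _ => D) _ nil); [lra|apply ex_RInt_const|].
        intros x Hx _. destruct Rlt_dec; auto. exfalso; apply n, Hin; lra.
      + apply is_RInt_zero; [lra|]. intros x Hx. destruct Rlt_dec; auto. exfalso; apply (Hout x); auto; lra. }
    rewrite (is_RInt_unique _ _ _ _ E) RInt_const. unfold scal; simpl; unfold mult; simpl.
    apply Rle_lt_trans with (2 * D * (eps / (2 * (2 * D + 1)))); [nra|].
    apply Rmult_lt_reg_r with (2 * (2 * D + 1)); [lra|].
    replace (2 * D * (eps / (2 * (2 * D + 1))) * (2 * (2 * D + 1))) with (2 * D * eps) by (field; lra). nra.
Qed.

(** * Iterated Gaussian expectations *)

Lemma gauss_exp_ext n : forall F F' v, (forall l, length l = n -> F l = F' l) ->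
  gauss_exp n F v -> gauss_exp n F' v.
Proof.
  induction n as [|n IH]; simpl; intros F F' v HF H.
  - now rewrite <- HF.
  - destruct H as [g [Hg Hv]]. exists g. split; [|exact Hv]. intros t.
    apply IH with (2 := Hg t). intros l Hl. apply HF. simpl. lia.
Qed.

Lemma gauss_exp_const n c : gauss_exp n (fun _ => c) c.
Proof.
  induction n as [|n IH]; simpl; [reflexivity|]. exists (fun _ => c). split; [auto|].
  pose proof (improper_int_scal _ _ c improper_int_gauss) as H. now rewrite Rmult_1_r in H.
Qed.

Lemma gauss_exp_le n c : forall F F' v v', gauss_exp n F v -> gauss_exp n F' v' ->
  (forall l, length l = n -> F l <= F' l + c) -> v <= v' + c.
Proof.
  induction n as [|n IH]; simpl; intros F F' v v' H H' HF.
  - rewrite H H'. now apply HF.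
  - destruct H as [g [Hg Hv]]. destruct H' as [g' [Hg' Hv']].
    pose proof (improper_int_plus _ _ _ _ Hv' (improper_int_scal _ _ c improper_int_gauss)) as K.
    rewrite Rmult_1_r in K. apply (improper_int_le _ _ _ _ Hv K). intros t.
    assert (g t <= g' t + c).
    { apply (IH _ _ _ _ (Hg t) (Hg' t)). intros l Hl. apply HF. simpl. lia. }
    pose proof (gauss_density_pos t). nra.
Qed.

Lemma gauss_exp_plus n : forall F F' v v', gauss_exp n F v -> gauss_exp n F' v' ->
  gauss_exp n (fun l => F l + F' l) (v + v').
Proof.
  induction n as [|n IH]; simpl; intros F F' v v' H H'.
  - now rewrite H H'.
  - destruct H as [g [Hg Hv]]. destruct H' as [g' [Hg' Hv']].
    exists (fun t => g t + g' t). split; [intros t; now apply IH|].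
    pose proof (improper_int_plus _ _ _ _ Hv Hv') as K.
    apply improper_int_ext with (2 := K). intros t. ring.
Qed.

Lemma gauss_exp_scal n c : forall F v, gauss_exp n F v -> gauss_exp n (fun l => c * F l) (c * v).
Proof.
  induction n as [|n IH]; simpl; intros F v H.
  - now rewrite H.
  - destruct H as [g [Hg Hv]].
    exists (fun t => c * g t). split; [intros t; now apply IH|].
    pose proof (improper_int_scal _ _ c Hv) as K.
    apply improper_int_ext with (2 := K). intros t. ring.
Qed.

(** The head of the list is the outermost variable and the last coefficient the innermost, so
    conditioning on all but the last is a regrouping of the same iterated integral, with no change
    of order. *)
Lemma gauss_exp_snoc n : forall F G v,
  (forall l, length l = n -> gauss_exp 1 (fun l' => F (l ++ l')) (G l)) ->
  gauss_exp n G v -> gauss_exp (S n) F v.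
Proof.
  induction n as [|n IH]; intros F G v H HG.
  - simpl in HG. subst v. exact (H nil eq_refl).
  - destruct HG as [g [Hg Hv]]. exists g. split; [|exact Hv]. intros t.
    apply (IH (fun l => F (t :: l)) (fun l => G (t :: l))); [|exact (Hg t)].
    intros l Hl. apply (H (t :: l)). simpl. lia.
Qed.

Definition in_box (d M t : R) : Prop := d <= Rabs t <= M.

(** [chi] is the indicator of (-d, d) plus t^2 / M^2. The density is at most 1, which gives 2 d; the
    second moment gives the tail, as in Chebyshev's inequality. *)
Lemma gauss_off_box d M : 0 < d -> 0 < M -> exists chi m, (forall t, 0 <= chi t) /\
  (forall t, ~ in_box d M t -> 1 <= chi t) /\
  improper_int (fun t => chi t * gauss_density t) m /\ m <= 2 * d + / M ^ 2.
Proof.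
  intros Hd HM. pose (J := fun t => - d < t < d).
  destruct (completeness (fun y => exists u v, J u /\ J v /\ u <= v /\ y = Phi v - Phi u)) as [V HV].
  { exists (2 * d). intros y [u [v [Hu [Hv [Huv ->]]]]]. unfold J in *.
    pose proof (Phi_lip u v Huv). lra. }
  { exists (Phi 0 - Phi 0), 0, 0. unfold J. repeat split; lra. }
  assert (V <= 2 * d).
  { apply HV. intros y [u [v [Hu [Hv [Huv ->]]]]]. unfold J in *.
    pose proof (Phi_lip u v Huv). lra. }
  assert (improper_int (fun t => indic J t * gauss_density t) V) as HJ.
  { apply improper_int_indic; auto; unfold J; [intros; lra|exists 0; lra]. }
  pose proof (improper_int_plus _ _ _ _ HJ (improper_int_scal _ _ (/ M ^ 2) improper_int_gauss2)) as K.
  assert (0 < / M ^ 2) by (apply Rinv_0_lt_compat; nra).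
  exists (fun t => indic J t + / M ^ 2 * t ^ 2), (V + / M ^ 2 * 1). repeat split.
  - intros t. pose proof (indic_bounds J t). nra.
  - intros t Ht. pose proof (indic_bounds J t).
    destruct (Rlt_dec (Rabs t) d) as [Hlt|Hlt].
    + rewrite indic_in; [nra|]. apply Rabs_def2 in Hlt. unfold J. lra.
    + assert (M < Rabs t) as Hgt by (apply Rnot_le_lt; intros Hle; apply Ht; split; lra).
      assert (M ^ 2 <= t ^ 2) by (rewrite <- (pow2_abs t); nra).
      assert (1 <= / M ^ 2 * t ^ 2); [|lra].
      rewrite <- (Rinv_l (M ^ 2)); nra.
  - apply improper_int_ext with (2 := K). intros t. simpl. ring.
  - lra.
Qed.

(* Integration only sees the coefficients in a compact box avoiding zero, up to an
   error that is uniform over all pairs [F], [F']. *)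
Lemma gauss_exp_le_on_box n D e2 : 0 <= D -> 0 < e2 -> exists d M, 0 < d <= M /\
  forall F F' v v' e, 0 <= e -> gauss_exp n F v -> gauss_exp n F' v' ->
  (forall l, length l = n -> F l <= F' l + D) ->
  (forall l, length l = n -> List.Forall (in_box d M) l -> F l <= F' l + e) -> v <= v' + e + e2.
Proof.
  intros HD. revert e2. induction n as [|n IH]; intros e2 He2.
  - exists 1, 1. split; [lra|]. simpl. intros F F' v v' e He -> -> _ H.
    specialize (H nil eq_refl (Forall_nil _)). lra.
  - destruct (IH (e2 / 2) ltac:(lra)) as [d1 [M1 [Hd1 IH']]]. clear IH.
    (* The added coordinate may spend e2 / 2: off its box the mass is at most 2 (k / 2) + 1 / M2^2
       <= 2 k, and 2 k D <= e2 / 2. *)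
    pose (k := e2 / (4 * (D + 1))).
    assert (0 < k) by (apply Rdiv_lt_0_compat; lra).
    pose (M2 := 1 + 2 / k).
    assert (0 < 2 / k) by (apply Rdiv_lt_0_compat; lra).
    destruct (gauss_off_box (k / 2) M2 ltac:(lra) ltac:(unfold M2; lra)) as [chi [m [C0 [C1 [Cm Hm]]]]].
    assert (/ M2 ^ 2 <= k) as HM2.
    { apply Rmult_le_reg_r with (M2 ^ 2); [unfold M2; nra|].
      rewrite Rinv_l; [|unfold M2; nra].
      assert (2 <= k * M2) as HkM.
      { unfold M2. rewrite Rmult_plus_distr_l. replace (k * (2 / k)) with 2 by (field; lra). lra. }
      assert (1 <= M2) by (unfold M2; lra). nra. }
    exists (Rmin d1 (k / 2)), (Rmax M1 M2).
    pose proof (Rmin_l d1 (k / 2)). pose proof (Rmin_r d1 (k / 2)).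
    pose proof (Rmax_l M1 M2). pose proof (Rmax_r M1 M2).
    split; [split; [apply Rmin_pos; lra|lra]|].
    intros F F' v v' e He [g [Hg Hv]] [g' [Hg' Hv']] HFD HFe.
    pose proof (improper_int_plus _ _ _ _ (improper_int_plus _ _ _ _ Hv'
      (improper_int_scal _ _ (e + e2 / 2) improper_int_gauss)) (improper_int_scal _ _ D Cm)) as K.
    apply Rle_trans with (v' + (e + e2 / 2) * 1 + D * m).
    + apply (improper_int_le _ _ _ _ Hv K). intros t. pose proof (gauss_density_pos t).
      assert (g t <= g' t + (e + e2 / 2) + D * chi t); [|nra].
      destruct (classic (in_box (k / 2) M2 t)) as [Hb|Hb].
      * assert (g t <= g' t + e + e2 / 2); [|specialize (C0 t); nra].
        apply (IH' _ _ _ _ e He (Hg t) (Hg' t)).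
        { intros l Hl. apply HFD. simpl. lia. }
        intros l Hl Hbox. apply HFe; [simpl; lia|]. constructor.
        { destruct Hb; split; lra. }
        apply Forall_impl with (2 := Hbox). intros a [? ?]. split; lra.
      * assert (g t <= g' t + D); [|specialize (C1 t Hb); nra].
        apply (gauss_exp_le n D _ _ _ _ (Hg t) (Hg' t)).
        intros l Hl. apply HFD. simpl. lia.
    + assert (D * m <= e2 / 2); [|lra].
      apply Rle_trans with (D * (2 * k)); [apply Rmult_le_compat_l; lra|].
      unfold k. apply Rmult_le_reg_r with (4 * (D + 1)); [lra|].
      replace (D * (2 * (e2 / (4 * (D + 1)))) * (4 * (D + 1))) with (2 * D * e2) by (field; lra). nra.
Qed.

Definition near_in_box (d M h t t' : R) : Prop :=
  (t = 0 /\ t' = 0) \/ (in_box d M t /\ in_box d M t' /\ Rabs (t - t') <= h).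

(* Uniform continuity separately on each coordinate stratum (a coefficient is either
   exactly zero or bounded away from zero): across strata the expected number of zeros
   in [(0, r)] does jump. *)
Definition stratified (n : nat) (D : R) (F : list R -> R) : Prop :=
  (forall l, length l = n -> 0 <= F l <= D) /\
  forall d M e, 0 < d -> 0 < e -> exists h, 0 < h /\ forall l l', length l = n ->
    Forall2 (near_in_box d M h) l l' -> Rabs (F l - F l') <= e.

Lemma near_in_box_weaken d M h d' M' t t' : d' <= d -> M <= M' ->
  near_in_box d M h t t' -> near_in_box d' M' h t t'.
Proof.
  intros Hd HM [H|[[? ?] [[? ?] ?]]]; [now left|right]. unfold in_box. repeat split; lra.
Qed.

Lemma Forall2_impl_R (P Q : R -> R -> Prop) l l' : (forall x y, P x y -> Q x y) ->
  Forall2 P l l' -> Forall2 Q l l'.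
Proof. intros H K. induction K; constructor; auto. Qed.

(** A fixed head is either 0 or at a positive distance from 0; in the second case, shrinking d below
    |t| and raising M above it puts the pair (t, t) in the box. *)
Lemma stratified_cons n D F t : stratified (S n) D F -> stratified n D (fun l => F (t :: l)).
Proof.
  intros [HD HU]. split; [intros l Hl; apply HD; simpl; lia|].
  intros d M e Hd He.
  assert (exists d', 0 < d' <= d /\ (t = 0 \/ d' <= Rabs t)) as [d' [Hd' Ht]].
  { destruct (Req_dec t 0) as [Ht|Ht]; [exists d; split; auto; lra|].
    exists (Rmin d (Rabs t)). pose proof (Rabs_pos_lt t Ht). pose proof (Rmin_l d (Rabs t)).
    split; [split; [apply Rmin_pos; lra|lra]|]. right. apply Rmin_r. }
  destruct (HU d' (Rmax M (Rabs t)) e ltac:(lra) He) as [h [Hh HF]].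
  exists h. split; [assumption|]. intros l l' Hl Hll. apply HF; [simpl; lia|].
  constructor.
  - destruct Ht as [Ht|Ht]; [now left|right].
    pose proof (Rmax_r M (Rabs t)). rewrite Rminus_diag Rabs_R0.
    unfold in_box. repeat split; lra.
  - apply Forall2_impl_R with (2 := Hll). intros x y. apply near_in_box_weaken; [lra|apply Rmax_l].
Qed.

Lemma Phi_abs_le x : - / 2 <= Phi x <= / 2.
Proof.
  pose proof Phi_0. destruct (Rle_dec 0 x) as [H'|H'].
  - pose proof (Phi_bounds x H'). pose proof (Phi_le 0 x H'). lra.
  - pose proof (Phi_bounds (- x) ltac:(lra)). pose proof (Phi_le x 0 ltac:(lra)).
    rewrite Phi_opp in H0. lra.
Qed.

Lemma continuous_eps (g : R -> R) (t0 : R) :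
  (forall e, 0 < e -> exists d, 0 < d /\ forall t, Rabs (t - t0) < d -> Rabs (g t - g t0) < e) ->
  continuous g t0.
Proof.
  intros H. apply continuity_pt_filterlim. intros e He. destruct (H e He) as [d [Hd Hg]].
  exists d. split; [exact Hd|]. intros t [_ Ht]. exact (Hg t Ht).
Qed.

(** By induction the expectation over the tail is a function g of the head with values in [0, D] and
    continuous off 0, so its product with the density is integrable on windows. The window integrals
    are increasing and bounded by D. *)
Lemma gauss_exp_exists n : forall D F, stratified n D F ->
  exists v, gauss_exp n F v /\ 0 <= v <= D.
Proof.
  induction n as [|n IH]; intros D F HF.
  - exists (F nil). split; [reflexivity|]. now apply HF.
  - assert (0 <= D) as HD.
    { destruct HF as [HF _]. specialize (HF (repeat 0 (S n)) (repeat_length _ _)). lra. }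
    assert (forall t, exists v, gauss_exp n (fun l => F (t :: l)) v /\ 0 <= v <= D) as K.
    { intros t. apply IH. now apply stratified_cons. }
    pose (g := fun t => proj1_sig (constructive_indefinite_description _ (K t))).
    assert (forall t, gauss_exp n (fun l => F (t :: l)) (g t) /\ 0 <= g t <= D) as Hg.
    { intros t. unfold g. now destruct constructive_indefinite_description. }
    (* A small move of t keeps it on the stratum of t0. On the box for the tail this changes F by at
       most e / 4, and [gauss_exp_le_on_box] charges another e / 4 for the rest; the estimate is
       used in both directions. *)
    assert (forall t, t <> 0 -> continuous g t) as Hc.
    { intros t0 Ht0. apply continuous_eps. intros e He.
      destruct (gauss_exp_le_on_box n D (e / 4) HD ltac:(lra)) as [d [M [Hd HB]]].
      pose proof (Rabs_pos_lt t0 Ht0) as At0.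
      pose proof (Rmin_l d (Rabs t0 / 2)). pose proof (Rmin_r d (Rabs t0 / 2)).
      assert (0 < Rmin d (Rabs t0 / 2)) as Hdpos by (apply Rmin_pos; lra).
      pose proof (Rmax_l M (2 * Rabs t0)). pose proof (Rmax_r M (2 * Rabs t0)).
      destruct HF as [HFD HFU].
      destruct (HFU (Rmin d (Rabs t0 / 2)) (Rmax M (2 * Rabs t0)) (e / 4) Hdpos ltac:(lra)) as [h [Hh HU]].
      exists (Rmin h (Rabs t0 / 2)). split; [apply Rmin_pos; lra|].
      intros t Ht.
      pose proof (Rmin_l h (Rabs t0 / 2)). pose proof (Rmin_r h (Rabs t0 / 2)).
      assert (Rabs t0 / 2 <= Rabs t <= 2 * Rabs t0) as Hbt.
      { pose proof (Rabs_triang_inv t0 t). rewrite Rabs_minus_sym in H5.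
        pose proof (Rabs_triang (t - t0) t0).
        replace (t - t0 + t0) with t in H6 by ring. lra. }
      assert (forall l, length l = n -> List.Forall (in_box d M) l ->
        Rabs (F (t :: l) - F (t0 :: l)) <= e / 4) as Hclose.
      { intros l Hl Hbox. apply HU; [simpl; lia|]. constructor.
        - right. unfold in_box. repeat split; lra.
        - clear Hl. induction Hbox as [|x l Hx Hbox IHl]; constructor; auto.
          right. destruct Hx. rewrite Rminus_diag Rabs_R0. unfold in_box. repeat split; lra. }
      destruct (Hg t) as [G1 _]. destruct (Hg t0) as [G2 _].
      assert (g t <= g t0 + e / 4 + e / 4).
      { apply (HB _ _ _ _ (e / 4) ltac:(lra) G1 G2).
        - intros l Hl. pose proof (HFD (t :: l) ltac:(simpl; lia)).
          pose proof (HFD (t0 :: l) ltac:(simpl; lia)). lra.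
        - intros l Hl Hbox. specialize (Hclose l Hl Hbox). apply Rabs_le_between in Hclose. lra. }
      assert (g t0 <= g t + e / 4 + e / 4).
      { apply (HB _ _ _ _ (e / 4) ltac:(lra) G2 G1).
        - intros l Hl. pose proof (HFD (t :: l) ltac:(simpl; lia)).
          pose proof (HFD (t0 :: l) ltac:(simpl; lia)). lra.
        - intros l Hl Hbox. specialize (Hclose l Hl Hbox). apply Rabs_le_between in Hclose. lra. }
      apply Rabs_def1; lra. }
    assert (forall t, 0 <= g t * gauss_density t <= D) as Hgd.
    { intros t. destruct (Hg t) as [_ ?]. pose proof (gauss_density_pos t).
      pose proof (gauss_density_le_1 t). nra. }
    assert (forall a b, a <= b -> ex_RInt (fun t => g t * gauss_density t) a b) as Ex.
    { intros a b Hab. apply ex_RInt_bounded_off_0 with D; auto. intros t Ht.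
      apply: (continuous_mult g gauss_density); [auto|apply continuous_gauss_density]. }
    destruct (improper_int_bounded (fun t => g t * gauss_density t) D) as [v Hv]; auto.
    { intros t. apply Hgd. }
    { intros a b Hab. apply Rle_trans with (RInt (fun t => scal D (gauss_density t)) a b).
      - apply RInt_le; auto.
        + apply: ex_RInt_scal. apply ex_RInt_gauss.
        + intros t _. destruct (Hg t) as [_ ?]. pose proof (gauss_density_pos t).
          unfold scal; simpl; unfold mult; simpl. nra.
      - rewrite RInt_scal; [|apply ex_RInt_gauss]. rewrite RInt_gauss.
        unfold scal; simpl; unfold mult; simpl. pose proof (Phi_abs_le a). pose proof (Phi_abs_le b).
        nra. }
    assert (gauss_exp (S n) F v) as Hv' by (exists g; split; auto; intros t; apply Hg).
    exists v. split; [assumption|]. destruct HF as [HFD _]. split.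
    + pose proof (gauss_exp_le (S n) 0 _ _ _ _ (gauss_exp_const (S n) 0) Hv') as E.
      rewrite Rplus_0_r in E. apply E. intros l Hl. specialize (HFD l Hl). lra.
    + pose proof (gauss_exp_le (S n) D _ _ _ _ Hv' (gauss_exp_const (S n) 0)) as E.
      rewrite Rplus_0_l in E. apply E. intros l Hl. specialize (HFD l Hl). lra.
Qed.

(** * Zeros of generalised polynomials and the Banach indicatrix *)

Lemma MVT_pos (f df : R -> R) a b : 0 < a -> a < b -> (forall x, 0 < x -> is_derive f x (df x)) ->
  exists c, a <= c <= b /\ f b - f a = df c * (b - a).
Proof.
  intros Ha Hab Hf. destruct (MVT_gen f a b df) as [c [Hc E]].
  - intros x. rewrite Rmin_left; [|lra]. intros Hx. apply Hf. lra.
  - intros x. rewrite Rmin_left; [|lra]. intros Hx. apply derivable_continuous_pt.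
    exists (df x). apply is_derive_Reals, Hf. lra.
  - rewrite Rmin_left in Hc; [|lra]. rewrite Rmax_right in Hc; [|lra]. now exists c.
Qed.

(** Rolle: between critical points there is at most one zero. Cutting at one critical point hands
    the remaining list to both halves, hence the power of 2; counting one more than the number of
    zeros absorbs the cut point and closes the induction. *)
Lemma zeros_from_derivative (f df : R -> R) (L : list R) :
  (forall x, 0 < x -> is_derive f x (df x)) ->
  forall lo hi, 0 <= lo -> (forall x, lo < x < hi -> df x = 0 -> In x L) ->
  exists L', (S (length L') <= 2 ^ S (length L))%nat /\
    forall x, lo < x < hi -> f x = 0 -> In x L'.
Proof.
  intros Hf. induction L as [|c L IH]; intros lo hi Hlo HL.
  - destruct (classic (exists x, lo < x < hi /\ f x = 0)) as [[x [Hx fx]]|Hn].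
    2:{ exists nil. split; [simpl; lia|]. intros x Hx fx. apply Hn. now exists x. }
    exists [x]. split; [simpl; lia|]. intros y Hy fy. left. apply NNPP. intros Hxy.
    destruct (Rdichotomy _ _ Hxy) as [H|H].
    + destruct (MVT_pos f df x y ltac:(lra) H Hf) as [c [Hc E]].
      apply (HL c); [lra|]. rewrite fx fy in E. nra.
    + destruct (MVT_pos f df y x ltac:(lra) ltac:(lra) Hf) as [c [Hc E]].
      apply (HL c); [lra|]. rewrite fx fy in E. nra.
  - destruct (classic (lo < c < hi)) as [Hc|Hc].
    + destruct (IH lo c Hlo) as [L1 [N1 H1]].
      { intros x Hx E. destruct (HL x ltac:(lra) E); [lra|assumption]. }
      destruct (IH c hi ltac:(lra)) as [L2 [N2 H2]].
      { intros x Hx E. destruct (HL x ltac:(lra) E); [lra|assumption]. }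
      exists (c :: L1 ++ L2). split.
      { simpl in *. rewrite length_app. lia. }
      intros x Hx E. destruct (Rtotal_order x c) as [H|[H|H]].
      * right. apply in_or_app. left. apply H1; auto; lra.
      * left. auto.
      * right. apply in_or_app. right. apply H2; auto; lra.
    + destruct (IH lo hi Hlo) as [L1 [N1 H1]].
      { intros x Hx E. destruct (HL x Hx E); [subst; contradiction|assumption]. }
      exists L1. split; [simpl in *; lia|assumption].
Qed.

Fixpoint dot (T L : list R) : R :=
  match T, L with
  | t :: T', l :: L' => t * l + dot T' L'
  | _, _ => 0
  end.

Lemma is_derive_Rpower z x : 0 < x -> is_derive (fun x => Rpower x z) x (z * Rpower x (z - 1)).
Proof.
  intros Hx. unfold Rpower. auto_derive; [assumption|].
  replace ((z - 1) * ln x) with (z * ln x + - ln x) by ring.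
  rewrite exp_plus exp_Ropp exp_ln; auto. field. lra.
Qed.

Lemma is_derive_dot (f df : R -> R -> R) T Z x :
  (forall z, is_derive (fun x => f x z) x (df x z)) ->
  is_derive (fun x => dot T (map (f x) Z)) x (dot T (map (df x) Z)).
Proof.
  intros H. revert Z. induction T as [|t T IH]; intros [|z Z]; simpl; try apply: is_derive_const.
  pose proof (is_derive_scal _ _ t _ (H z)) as K.
  pose proof (is_derive_plus _ _ _ _ _ K (IH Z)) as K2. exact K2.
Qed.

Lemma dot_map_shift (C Z : list R) x a : 0 < x ->
  dot C (map (fun z => Rpower x (z - a)) Z) = Rpower x (- a) * dot C (map (Rpower x) Z).
Proof.
  intros Hx. revert Z. induction C as [|c C IH]; intros [|z Z]; simpl; try ring.
  rewrite IH. unfold Rminus. rewrite Rpower_plus. ring.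
Qed.

Fixpoint zipmul (T L : list R) : list R :=
  match T, L with
  | t :: T', l :: L' => t * l :: zipmul T' L'
  | _, _ => nil
  end.

Lemma dot_zipmul T L M : dot (zipmul T L) M = dot T (zipmul L M).
Proof.
  revert L M. induction T as [|t T IH]; intros [|l L] [|m M]; simpl; auto. rewrite IH. ring.
Qed.

Lemma zipmul_map (f g : R -> R) Z : zipmul (map f Z) (map g Z) = map (fun z => f z * g z) Z.
Proof. induction Z as [|z Z IH]; simpl; [reflexivity|now rewrite IH]. Qed.

Lemma zipmul_neq0 C W : length C = length W -> (exists c, In c C /\ c <> 0) ->
  (forall w, In w W -> w <> 0) -> exists c, In c (zipmul C W) /\ c <> 0.
Proof.
  revert W. induction C as [|a C IH]; intros [|w W] Hl [c [Hc H0]] HW; simpl in *; try easy.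
  destruct Hc as [->|Hc].
  - exists (c * w). split; [now left|]. apply Rmult_integral_contrapositive_currified; auto.
  - destruct (IH W ltac:(lia)) as [d [Hd Hd0]]; eauto.
Qed.

Lemma length_zipmul C W : length C = length W -> length (zipmul C W) = length W.
Proof.
  revert W. induction C as [|a C IH]; intros [|w W] Hl; simpl in *; try easy. rewrite IH; lia.
Qed.

(* Generalised Descartes: divide by one monomial, differentiate, and use Rolle. *)
Lemma gpoly_zeros n : exists B, forall C Z, length Z = n -> length C = n -> NoDup Z ->
  (exists c, In c C /\ c <> 0) ->
  exists L, (length L <= B)%nat /\
    forall x, 0 < x < 1 -> dot C (map (Rpower x) Z) = 0 -> In x L.
Proof.
  induction n as [|n [B IH]].
  - exists 0%nat. intros [|c C] Z _ HC _ [d [Hd _]]; easy.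
  - exists (2 ^ S B)%nat. intros [|c C] [|z Z] HZ HC HN HC0; try easy.
    simpl in HZ, HC. inversion_clear HN.
    destruct (classic (exists c, In c C /\ c <> 0)) as [H1|H1].
    + pose (W := map (fun y => y - z) Z).
      destruct (IH (zipmul C W) (map (fun y => y - z - 1) Z)) as [L [HL HLx]].
      { rewrite length_map. lia. }
      { rewrite length_zipmul; unfold W; rewrite length_map; lia. }
      { apply FinFun.Injective_map_NoDup; auto. intros a b E. lra. }
      { apply zipmul_neq0; auto; [unfold W; rewrite length_map; lia|].
        intros w Hw. apply in_map_iff in Hw. destruct Hw as [y [<- Hy]].
        intros E. apply H. now replace z with y by lra. }
      (* After division by x^z the first term is constant, so [df] has one term fewer. The factors y
         - z that differentiation produces are nonzero because the exponents are distinct. *)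
      pose (f := fun x => dot (c :: C) (map (fun y => Rpower x (y - z)) (z :: Z))).
      pose (df := fun x => dot (c :: C) (map (fun y => (y - z) * Rpower x (y - z - 1)) (z :: Z))).
      destruct (zeros_from_derivative f df L) with (lo := 0) (hi := 1) as [L' [HL' HL'x]].
      { intros x Hx. apply (is_derive_dot (fun x y => Rpower x (y - z))
          (fun x y => (y - z) * Rpower x (y - z - 1))). intros y. now apply is_derive_Rpower. }
      { lra. }
      { intros x Hx E. apply HLx; auto. rewrite dot_zipmul. unfold W.
        rewrite map_map zipmul_map. unfold df in E. simpl in E. rewrite Rminus_diag in E.
        lra. }
      exists L'. split.
      { apply Nat.lt_le_incl. apply Nat.lt_le_trans with (1 := HL').
        apply Nat.pow_le_mono_r; lia. }
      intros x Hx E. apply HL'x; auto. unfold f. rewrite dot_map_shift; [|lra].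
      rewrite E. ring.
    + exists nil. split; [simpl; lia|]. intros x Hx E. simpl in E.
      assert (dot C (map (Rpower x) Z) = 0) as E0.
      { clear - H1. revert Z. induction C as [|d C IHC]; intros [|y Z]; simpl; auto.
        rewrite IHC.
        - assert (d = 0) as ->; [|ring]. apply NNPP. intros Hd. apply H1. exists d. simpl; auto.
        - intros [e [He He0]]. apply H1. exists e. simpl; auto. }
      assert (c <> 0).
      { destruct HC0 as [d [[->|Hd] Hd0]]; auto. exfalso. apply H1. now exists d. }
      unfold Rpower in E at 1. pose proof (exp_pos (z * ln x)). rewrite E0 in E. nra.
Qed.

(** * The Banach indicatrix for the Gaussian weight *)

Definition C1_pos (h dh : R -> R) : Prop :=
  forall x, 0 < x -> is_derive h x (dh x) /\ continuous dh x.

Definition kac (h dh : R -> R) (x : R) : R := Rabs (dh x) * gauss_density (h x).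

(** A supremum instead of an integral from [lo], because at [lo] = 0 the function h may blow up; for
    a nonnegative integrand this is the improper integral. *)
Definition kac_integral (h dh : R -> R) (lo hi V : R) : Prop :=
  is_lub (fun y => exists a, lo < a < hi /\ y = RInt (kac h dh) a hi) V.

(** Finitely many levels [Lx] are exempt from the count: those of the points where monotone pieces
    are glued. They do not affect the Riemann integral. *)
Definition crossings (h dh : R -> R) (lo hi V : R) : Prop :=
  exists N Lx, (forall t, ~ In t Lx -> exists l, NoDup l /\
      (forall x, In x l <-> lo < x < hi /\ h x = t) /\ N t = INR (length l)) /\
    improper_int (fun t => N t * gauss_density t) V.

Lemma C1_pos_continuous h dh x : C1_pos h dh -> 0 < x -> continuous h x.
Proof. intros H Hx. apply: ex_derive_continuous. exists (dh x). now apply H. Qed.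

Lemma kac_continuous h dh x : C1_pos h dh -> 0 < x -> continuous (kac h dh) x.
Proof.
  intros H Hx. apply: (continuous_mult (fun x => Rabs (dh x)) (fun x => gauss_density (h x))).
  - apply: continuous_comp; [now apply H|apply: continuous_Rabs].
  - apply: continuous_comp; [now apply C1_pos_continuous with dh|apply continuous_gauss_density].
Qed.

Lemma kac_ex_RInt h dh a b : C1_pos h dh -> 0 < a -> a <= b -> ex_RInt (kac h dh) a b.
Proof.
  intros H Ha Hab. apply: ex_RInt_continuous. rewrite Rmin_left // Rmax_right //.
  intros x Hx. apply kac_continuous; auto; lra.
Qed.

Lemma kac_nonneg h dh x : 0 <= kac h dh x.
Proof. apply Rmult_le_pos; [apply Rabs_pos|left; apply gauss_density_pos]. Qed.

Lemma kac_RInt_nonneg h dh a b : C1_pos h dh -> 0 < a -> a <= b -> 0 <= RInt (kac h dh) a b.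
Proof.
  intros. apply RInt_ge_0; auto; [now apply kac_ex_RInt|]. intros; apply kac_nonneg.
Qed.

Lemma is_derive_Phi_comp h dh x : C1_pos h dh -> 0 < x ->
  is_derive (fun x => Phi (h x)) x (dh x * gauss_density (h x)).
Proof.
  intros H Hx. destruct (H x Hx) as [H1 _].
  exact (is_derive_comp Phi h x _ _ (is_derive_Phi (h x)) H1).
Qed.

Lemma kac_RInt_monotone h dh s a b : C1_pos h dh -> 0 < a -> a <= b -> (s = 1 \/ s = -1) ->
  (forall x, a < x < b -> 0 < s * dh x) ->
  (RInt (kac h dh) a b : R) = s * (Phi (h b) - Phi (h a)).
Proof.
  intros H Ha Hab Hs Hd. apply is_RInt_unique.
  assert (forall x, 0 < x -> is_derive (fun x => s * Phi (h x)) x (s * (dh x * gauss_density (h x)))) as D.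
  { intros x Hx. apply: is_derive_scal. now apply is_derive_Phi_comp. }
  replace (s * (Phi (h b) - Phi (h a))) with (s * Phi (h b) - s * Phi (h a)) by ring.
  assert (forall x, 0 < x -> continuous (fun x => s * (dh x * gauss_density (h x))) x) as Cn.
  { intros x Hx. apply: (continuous_scal_r s (fun x => dh x * gauss_density (h x))).
    apply: (continuous_mult dh (fun x => gauss_density (h x))); [now apply H|].
    apply: continuous_comp; [now apply C1_pos_continuous with dh|apply continuous_gauss_density]. }
  assert (is_RInt (fun x => s * (dh x * gauss_density (h x))) a b (s * Phi (h b) - s * Phi (h a))) as K.
  { apply (is_RInt_FTC (fun x => s * Phi (h x))); auto.
    - intros x Hx. apply D; lra.
    - intros x Hx. apply Cn; lra. }
  apply: is_RInt_ext K. rewrite Rmin_left // Rmax_right //. intros x Hx. unfold kac.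
  specialize (Hd x Hx). rewrite <- Rmult_assoc. f_equal.
  destruct Hs as [-> | ->]; [rewrite Rabs_right|rewrite Rabs_left]; lra.
Qed.

Lemma IVT_any (f : R -> R) a b : a < b -> (forall x, a <= x <= b -> continuous f x) ->
  f a * f b < 0 -> exists c, a < c < b /\ f c = 0.
Proof.
  intros Hab Hc Hf.
  assert (forall x, a <= x <= b -> continuity_pt f x) as Hc'.
  { intros x Hx. apply continuity_pt_filterlim, Hc, Hx. }
  assert (exists c, a <= c <= b /\ f c = 0) as [c [Hcab E]].
  { destruct (Rlt_dec (f a) 0) as [Ha|Ha].
    - destruct (IVT_interv f a b Hc' Hab Ha ltac:(nra)) as [c Hcc]. now exists c.
    - assert (forall x, a <= x <= b -> continuity_pt (fun x => - f x) x) as Hopp.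
      { intros x Hx. apply (continuity_pt_opp f). auto. }
      assert (0 < f a) by (destruct (Req_dec (f a) 0) as [E|E]; [rewrite E in Hf|]; lra).
      assert (f b < 0) by nra.
      destruct (IVT_interv (fun x => - f x) a b Hopp Hab ltac:(cbv beta; lra) ltac:(cbv beta; lra)) as [c [Hcc E]].
      exists c. split; auto; lra. }
  exists c. split; auto.
  destruct (Req_dec c a) as [->|]; [nra|]. destruct (Req_dec c b) as [->|]; [nra|]. lra.
Qed.

Lemma constant_sign (f : R -> R) lo hi : lo < hi -> (forall x, lo < x < hi -> continuous f x) ->
  (forall x, lo < x < hi -> f x <> 0) ->
  exists s, (s = 1 \/ s = -1) /\ forall x, lo < x < hi -> 0 < s * f x.
Proof.
  intros Hlh Hc H0. pose (m := (lo + hi) / 2). assert (lo < m < hi) as Hm by (unfold m; lra).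
  assert (forall x, lo < x < hi -> 0 < f m * f x) as Hs.
  { intros x Hx. apply Rnot_le_lt. intros Hle.
    pose proof (H0 x Hx). pose proof (H0 m Hm).
    assert (f m * f x < 0) as Hlt.
    { destruct Hle as [|E]; auto. apply Rmult_integral in E. tauto. }
    destruct (Rtotal_order m x) as [L|[->|L]]; [|nra|].
    - destruct (IVT_any f m x L) as [c [? E]]; auto; [intros; apply Hc; lra|]. apply (H0 c); auto; lra.
    - destruct (IVT_any f x m L) as [c [? E]]; [intros; apply Hc; lra|lra|]. apply (H0 c); auto; lra. }
  pose proof (H0 m Hm). destruct (Rdichotomy _ _ H) as [L|L].
  - exists (-1). split; auto. intros x Hx. specialize (Hs x Hx). nra.
  - exists 1. split; auto. intros x Hx. specialize (Hs x Hx). nra.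
Qed.

Lemma continuous_eps_inv (g : R -> R) (t0 e : R) : continuous g t0 -> 0 < e ->
  exists d, 0 < d /\ forall t, Rabs (t - t0) < d -> Rabs (g t - g t0) < e.
Proof.
  intros H He. apply continuity_pt_filterlim in H. destruct (H e He) as [d [Hd Hg]].
  exists d. split; [exact Hd|]. intros t Ht.
  destruct (Req_dec t t0) as [->|Hn]; [rewrite Rminus_diag Rabs_R0; exact He|].
  apply (Hg t). split; [split; [exact I|auto]|exact Ht].
Qed.

(** A monotone piece takes each level of the interval [J] of its values exactly once, so the
    counting function is the indicator of [J]. Both quantities are then the Gaussian mass of [J],
    since |h'| phi(h) is the derivative of Phi(h) up to a fixed sign. *)
Lemma crossings_monotone h dh lo hi : C1_pos h dh -> 0 <= lo < hi ->
  (forall x, lo < x < hi -> dh x <> 0) ->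
  exists V, V <= 1 /\ crossings h dh lo hi V /\ kac_integral h dh lo hi V.
Proof.
  intros H Hlh Hd.
  destruct (constant_sign dh lo hi) as [s [Hs Hsd]]; auto; [lra|intros x Hx; apply H; lra|].
  assert (forall a b, lo < a -> a <= b -> b <= hi ->
    (RInt (kac h dh) a b : R) = s * (Phi (h b) - Phi (h a))) as HI.
  { intros a b Ha Hab Hb. apply kac_RInt_monotone; auto; [lra|]. intros x Hx. apply Hsd. lra. }
  assert (forall a b, lo < a -> a < b -> b < hi -> 0 < s * (h b - h a)) as Hmon.
  { intros a b Ha Hab Hb. destruct (MVT_pos h dh a b ltac:(lra) Hab) as [c [Hc E]].
    { intros x Hx. now apply H. }
    rewrite E. specialize (Hsd c ltac:(lra)). rewrite <- Rmult_assoc. apply Rmult_lt_0_compat; lra. }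
  pose (J := fun t => exists x, lo < x < hi /\ h x = t).
  assert (forall x y z, J x -> J z -> x <= y <= z -> J y) as HJ.
  { intros x y z [a [Ha <-]] [b [Hb <-]] Hy.
    destruct (Req_dec (h a) y) as [<-|Ea]; [now exists a|].
    destruct (Req_dec (h b) y) as [<-|Eb]; [now exists b|].
    assert (forall u v, lo < u -> v < hi -> u < v -> (h u - y) * (h v - y) < 0 -> J y) as K.
    { intros u v Hu Hv Huv Hlt. destruct (IVT_any (fun x => h x - y) u v Huv) as [c [Hc E]]; auto.
      - intros x Hx. apply: (continuous_minus h (fun _ => y)); [|apply: continuous_const].
        apply C1_pos_continuous with dh; auto; lra.
      - exists c. split; lra. }
    destruct (Rtotal_order a b) as [L|[->|L]].
    - apply (K a b); try lra. nra.
    - exists b. split; auto; lra.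
    - apply (K b a); try lra. nra. }
  assert (0 < (lo + hi) / 2) by lra.
  assert (J (h ((lo + hi) / 2))) as HJm by (exists ((lo + hi) / 2); split; auto; lra).
  destruct (completeness (fun y => exists u v, J u /\ J v /\ u <= v /\ y = Phi v - Phi u)) as [V HV].
  { exists 1. intros y [u [v [_ [_ [_ ->]]]]]. pose proof (Phi_abs_le u). pose proof (Phi_abs_le v). lra. }
  { exists (Phi (h ((lo + hi) / 2)) - Phi (h ((lo + hi) / 2))). do 2 eexists.
    repeat split; try apply HJm; lra. }
  exists V. repeat split.
  - apply HV. intros y [u [v [_ [_ [_ ->]]]]]. pose proof (Phi_abs_le u). pose proof (Phi_abs_le v). lra.
  - exists (indic J), nil. split.
    + intros t _. destruct (classic (J t)) as [Jt|Jt].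
      * rewrite indic_in //. destruct Jt as [x [Hx E]]. exists [x].
        split; [repeat constructor; auto|]. split; [|reflexivity].
        intros y. split; [intros [->|[]]; auto|]. intros [Hy Ey]. left.
        destruct (Rtotal_order x y) as [L|[->|L]]; auto; exfalso.
        -- pose proof (Hmon x y ltac:(lra) L ltac:(lra)). nra.
        -- pose proof (Hmon y x ltac:(lra) L ltac:(lra)). nra.
      * rewrite indic_out //. exists nil. split; [constructor|]. split; [|reflexivity].
        intros x. split; [intros []|]. intros K. apply Jt. now exists x.
    + apply improper_int_indic; auto. eauto.
  (* The value at [hi] need not belong to [J]; it is approached by a point b < [hi] through the
     continuity of Phi(h). *)
  - intros y [a [Ha ->]]. apply le_epsilon. intros e He.
    destruct (continuous_eps_inv (fun x => Phi (h x)) hi e) as [d [Hd0 Hd1]]; auto.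
    { apply: ex_derive_continuous. eexists. exact (is_derive_Phi_comp h dh hi H ltac:(lra)). }
    pose (b := Rmax a (hi - d / 2)).
    assert (a <= b) by apply Rmax_l. assert (hi - d / 2 <= b) by apply Rmax_r.
    assert (b < hi) by (apply Rmax_lub_lt; lra).
    specialize (Hd1 b). rewrite Rabs_minus_sym Rabs_right in Hd1; [|lra].
    specialize (Hd1 ltac:(lra)). apply Rabs_def2 in Hd1.
    assert (s * (Phi (h b) - Phi (h a)) <= V).
    { apply HV. destruct (Rle_lt_or_eq_dec a b) as [L|E]; auto.
      - pose proof (Hmon a b ltac:(lra) L ltac:(lra)). destruct Hs as [-> | ->].
        + exists (h a), (h b). repeat split; [exists a|exists b| |]; try lra; split; auto; lra.
        + exists (h b), (h a). repeat split; [exists b|exists a| |]; try lra; split; auto; lra.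
      - exists (h a), (h a). rewrite <- E. repeat split; try lra; exists a; split; auto; lra. }
    rewrite HI; try lra. destruct Hs as [-> | ->]; lra.
  (* Up to sign, Phi v - Phi u is the difference of the integrals from the two preimages a and b to
     [hi], each of them in [0, w]. *)
  - intros w Hw. apply HV. intros y [u [v [[a [Ha <-]] [[b [Hb <-]] [Huv ->]]]]].
    pose proof (Hw _ (ex_intro _ a (conj Ha eq_refl))) as Wa. rewrite HI in Wa; try lra.
    pose proof (Hw _ (ex_intro _ b (conj Hb eq_refl))) as Wb. rewrite HI in Wb; try lra.
    pose proof (kac_RInt_nonneg h dh a hi H ltac:(lra) ltac:(lra)) as Na. rewrite HI in Na; try lra.
    pose proof (kac_RInt_nonneg h dh b hi H ltac:(lra) ltac:(lra)) as Nb. rewrite HI in Nb; try lra.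
    destruct Hs as [-> | ->]; lra.
Qed.

(** Away from 0 the integrand is continuous up to the left end, so the supremum becomes an ordinary
    integral that can be split. *)
Lemma kac_integral_from_pos h dh lo hi V : C1_pos h dh -> 0 < lo < hi ->
  kac_integral h dh lo hi V -> V = RInt (kac h dh) lo hi.
Proof.
  intros H Hlh [Hub Hlub]. apply Rle_antisym.
  - apply Hlub. intros y [a [Ha ->]].
    rewrite (RInt_split (kac h dh) lo a hi); try (apply kac_ex_RInt; auto; lra).
    pose proof (kac_RInt_nonneg h dh lo a H ltac:(lra) ltac:(lra)). lra.
  - apply le_epsilon. intros e He.
    destruct (continuous_eps_inv (fun x => RInt (kac h dh) lo x) lo e) as [d [Hd0 Hd1]]; auto.
    { apply: ex_derive_continuous. exists (kac h dh lo).
      apply: (is_derive_RInt (kac h dh) (fun x => RInt (kac h dh) lo x) lo lo).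
      - exists (mkposreal (lo / 2) ltac:(lra)). intros y Hy. apply: RInt_correct.
        unfold ball in Hy; simpl in Hy; unfold AbsRing_ball, abs, minus, plus, opp in Hy; simpl in Hy.
        apply Rabs_def2 in Hy.
        destruct (Rle_dec lo y); [apply kac_ex_RInt; auto; lra|].
        apply ex_RInt_swap, kac_ex_RInt; auto; lra.
      - apply kac_continuous; auto; lra. }
    pose (a := Rmin ((lo + hi) / 2) (lo + d / 2)).
    assert (a <= (lo + hi) / 2) by apply Rmin_l. assert (a <= lo + d / 2) by apply Rmin_r.
    assert (lo < a) as Hla by (apply Rmin_glb_lt; lra).
    assert (a < hi) as Hah by lra.
    specialize (Hd1 a). rewrite Rabs_right in Hd1; [|lra].
    specialize (Hd1 ltac:(lra)).
    replace (RInt (kac h dh) lo lo) with 0 in Hd1 by (symmetry; exact (RInt_point lo (kac h dh))).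
    apply Rabs_def2 in Hd1.
    pose proof (Hub _ (ex_intro _ a (conj (conj Hla Hah) eq_refl))).
    rewrite (RInt_split (kac h dh) lo a hi); try (apply kac_ex_RInt; auto; lra). lra.
Qed.

Lemma kac_integral_nonneg h dh lo hi V : C1_pos h dh -> 0 <= lo < hi ->
  kac_integral h dh lo hi V -> 0 <= V.
Proof.
  intros H Hlh [Hub _].
  assert (lo < (lo + hi) / 2 < hi) as Hm by lra.
  pose proof (Hub _ (ex_intro _ ((lo + hi) / 2) (conj Hm eq_refl))) as K.
  pose proof (kac_RInt_nonneg h dh ((lo + hi) / 2) hi H ltac:(lra) ltac:(lra)). lra.
Qed.

(** Both sides are additive under cutting at a critical point. Every monotone piece contributes at
    most 1, and as both halves inherit the whole remaining list there are at most 2^|L| pieces. *)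
Lemma crossings_integral h dh (L : list R) : C1_pos h dh -> forall lo hi, 0 <= lo < hi ->
  (forall x, lo < x < hi -> dh x = 0 -> In x L) ->
  exists V, V <= 2 ^ length L /\ crossings h dh lo hi V /\ kac_integral h dh lo hi V.
Proof.
  intros H. induction L as [|c L IH]; intros lo hi Hlh HL.
  - simpl. apply crossings_monotone; auto.
  - assert (1 <= 2 ^ length L) as Hp by (apply pow_R1_Rle; lra).
    destruct (classic (lo < c < hi)) as [Hc|Hc].
    2:{ destruct (IH lo hi Hlh) as [V [V0 V1]].
        { intros x Hx E. destruct (HL x Hx E); [subst; contradiction|assumption]. }
        exists V. split; [simpl; lra|assumption]. }
    assert (0 <= lo < c) as Hlc by lra. assert (0 <= c < hi) as Hch by lra.
    assert (0 < c < hi) as Hch' by lra.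
    destruct (IH lo c Hlc) as [V1 [B1 [[N1 [L1 [C1 I1]]] K1]]].
    { intros x Hx E. destruct (HL x ltac:(lra) E); [lra|assumption]. }
    destruct (IH c hi Hch) as [V2 [B2 [[N2 [L2 [C2 I2]]] K2]]].
    { intros x Hx E. destruct (HL x ltac:(lra) E); [lra|assumption]. }
    pose proof (kac_integral_nonneg _ _ _ _ _ H Hlc K1) as P1.
    pose proof (kac_integral_from_pos _ _ _ _ _ H Hch' K2) as E2. clear K2.
    exists (V1 + V2). split; [simpl; lra|]. split.
    (* The cut point c lies in neither open half, so its level [h c] becomes exceptional. *)
    + exists (fun t => N1 t + N2 t), (h c :: L1 ++ L2). split.
      * intros t Ht. simpl in Ht. rewrite in_app_iff in Ht.
        destruct (C1 t ltac:(tauto)) as [l1 [D1 [Q1 M1]]].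
        destruct (C2 t ltac:(tauto)) as [l2 [D2 [Q2 M2]]].
        exists (l1 ++ l2). repeat split.
        -- apply NoDup_app; auto. intros x X1 X2. apply Q1 in X1. apply Q2 in X2. lra.
        -- apply in_app_iff in H0. destruct H0 as [X|X]; [apply Q1 in X|apply Q2 in X]; lra.
        -- apply in_app_iff in H0. destruct H0 as [X|X]; [apply Q1 in X|apply Q2 in X]; lra.
        -- apply in_app_iff in H0. destruct H0 as [X|X]; [apply Q1 in X|apply Q2 in X]; lra.
        -- intros [Hx E]. apply in_app_iff.
           destruct (Rtotal_order x c) as [X|[X|X]]; [left; apply Q1|subst x; tauto|right; apply Q2];
             split; auto; lra.
        -- rewrite length_app plus_INR. lra.
      * pose proof (improper_int_plus _ _ _ _ I1 I2) as I3.
        apply improper_int_ext with (2 := I3). intros t. ring.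
    + destruct K1 as [U1 M1]. split.
      * intros y [a [Ha ->]]. destruct (Rlt_dec a c) as [Hac|Hac].
        -- rewrite (RInt_split (kac h dh) a c hi); try (apply kac_ex_RInt; auto; lra).
           pose proof (U1 _ (ex_intro _ a (conj (conj (proj1 Ha) Hac) eq_refl))). lra.
        -- rewrite -> (RInt_split (kac h dh) c a hi) in E2 by (apply kac_ex_RInt; auto; lra).
           pose proof (kac_RInt_nonneg h dh c a H ltac:(lra) ltac:(lra)). lra.
      * intros w Hw. assert (V1 <= w - V2); [|lra]. apply M1. intros y [a [Ha ->]].
        assert (lo < a < hi) as Ha' by lra.
        pose proof (Hw _ (ex_intro _ a (conj Ha' eq_refl))) as K.
        rewrite (RInt_split (kac h dh) a c hi) in K; try (apply kac_ex_RInt; auto; lra). lra.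
Qed.

(** * Riemann sums for the conditional expectation *)

(* With [z = e_i - e_k], the polynomial [sum_i a_i x^(e_i)] vanishes at [x > 0] iff the last
   coefficient [a_k] equals [level Z T x], where [T] lists the other coefficients. *)
Definition level (Z T : list R) (x : R) : R := - dot T (map (Rpower x) Z).
Definition dlevel (Z T : list R) (x : R) : R := - dot T (map (fun z => z * Rpower x (z - 1)) Z).
Definition ddlevel (Z T : list R) (x : R) : R :=
  - dot T (map (fun z => z * ((z - 1) * Rpower x (z - 1 - 1))) Z).

Lemma is_derive_level Z T x : 0 < x -> is_derive (level Z T) x (dlevel Z T x).
Proof.
  intros Hx. apply: is_derive_opp.
  apply (is_derive_dot (fun x z => Rpower x z) (fun x z => z * Rpower x (z - 1))).
  intros z. now apply is_derive_Rpower.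
Qed.

Lemma is_derive_dlevel Z T x : 0 < x -> is_derive (dlevel Z T) x (ddlevel Z T x).
Proof.
  intros Hx. apply: is_derive_opp.
  apply (is_derive_dot (fun x z => z * Rpower x (z - 1)) (fun x z => z * ((z - 1) * Rpower x (z - 1 - 1)))).
  intros z. apply: is_derive_scal. now apply is_derive_Rpower.
Qed.

Lemma C1_pos_level Z T : C1_pos (level Z T) (dlevel Z T).
Proof.
  intros x Hx. split; [now apply is_derive_level|].
  apply: ex_derive_continuous. eexists. now apply is_derive_dlevel.
Qed.

(** A zero coefficient excuses its entry f z, which near x = 0 may be far larger than the active
    ones. *)
Lemma dot_bound (f : R -> R) M K T Z : 0 <= M -> 0 <= K ->
  (forall t z, In (t, z) (combine T Z) -> t = 0 \/ (Rabs t <= M /\ Rabs (f z) <= K)) ->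
  Rabs (dot T (map f Z)) <= INR (length T) * (M * K).
Proof.
  intros HM HK. assert (0 <= M * K) as HMK by nra. revert Z.
  induction T as [|t T IH]; intros [|z Z] H; cbn [dot map length combine] in *;
    try (rewrite Rabs_R0; apply Rmult_le_pos; [apply pos_INR|lra]).
  rewrite S_INR. eapply Rle_trans; [apply Rabs_triang|].
  assert (Rabs (dot T (map f Z)) <= INR (length T) * (M * K)) by (apply IH; intros; apply H; now right).
  assert (Rabs (t * f z) <= M * K); [|lra].
  destruct (H t z (or_introl eq_refl)) as [->|[H1 H2]].
  - rewrite Rmult_0_l Rabs_R0. assumption.
  - rewrite Rabs_mult. apply Rmult_le_compat; auto; apply Rabs_pos.
Qed.

Lemma dot_diff_bound (f : R -> R) e K T T' Z : 0 <= e -> 0 <= K ->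
  Forall2 (fun t t' => Rabs (t - t') <= e) T T' -> (forall z, In z Z -> Rabs (f z) <= K) ->
  Rabs (dot T (map f Z) - dot T' (map f Z)) <= INR (length T) * (e * K).
Proof.
  intros He HK HT. assert (0 <= e * K) as HMK by nra. revert Z.
  induction HT as [|t t' T T' Ht HT IH]; intros [|z Z] HZ; cbn [dot map length] in *;
    try (rewrite Rminus_diag Rabs_R0; apply Rmult_le_pos; [apply pos_INR|lra]).
  rewrite S_INR.
  replace (t * f z + dot T (map f Z) - (t' * f z + dot T' (map f Z))) with
    ((t - t') * f z + (dot T (map f Z) - dot T' (map f Z))) by ring.
  eapply Rle_trans; [apply Rabs_triang|].
  assert (Rabs (dot T (map f Z) - dot T' (map f Z)) <= INR (length T) * (e * K))
    by (apply IH; intros; apply HZ; now right).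
  assert (Rabs ((t - t') * f z) <= e * K); [|lra].
  rewrite Rabs_mult. apply Rmult_le_compat; auto; try apply Rabs_pos. apply HZ. now left.
Qed.

Lemma Rpower_pos x z : 0 < Rpower x z.
Proof. apply exp_pos. Qed.

Lemma exp_le x y : x <= y -> exp x <= exp y.
Proof. intros [H| ->]; [left; now apply exp_increasing|lra]. Qed.

Lemma ln_nonpos x : 0 < x <= 1 -> ln x <= 0.
Proof. intros [H0 [H| ->]]; [|rewrite ln_1; lra]. left. rewrite <- ln_1. now apply ln_increasing. Qed.

Lemma Rpower_le_base a x z : 0 < a <= x -> x <= 1 -> Rpower x z <= Rpower a (- Rabs z).
Proof.
  intros Ha Hx. unfold Rpower. apply exp_le.
  pose proof (ln_nonpos x ltac:(lra)) as H1.
  assert (ln a <= ln x) as H2 by (destruct Ha as [Ha [L| ->]]; [left; apply ln_increasing; lra|lra]).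
  pose proof (Rle_abs z). pose proof (Rle_abs (- z)). rewrite Rabs_Ropp in H0.
  pose proof (Rabs_pos z). nra.
Qed.

Lemma Rpower_le_1 x z : 0 < x <= 1 -> 0 <= z -> Rpower x z <= 1.
Proof.
  intros Hx Hz. unfold Rpower. rewrite <- exp_0. apply exp_le.
  pose proof (ln_nonpos x Hx). nra.
Qed.

Lemma Rpower_antitone x y z : 0 < x <= 1 -> y <= z -> Rpower x z <= Rpower x y.
Proof.
  intros Hx Hz. unfold Rpower. apply exp_le. pose proof (ln_nonpos x Hx). nra.
Qed.

Lemma powers_bound (Z : list R) a : 0 < a <= 1 -> exists K, 0 <= K /\ forall z x, In z Z -> a <= x <= 1 ->
  Rabs (Rpower x z) <= K /\ Rabs (z * Rpower x (z - 1)) <= K /\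
  Rabs (z * ((z - 1) * Rpower x (z - 1 - 1))) <= K.
Proof.
  intros Ha. induction Z as [|y Z [K [HK IH]]].
  - exists 0. split; [lra|]. intros z x [].
  - pose (A := Rpower a (- Rabs y)). pose (B := Rabs y * Rpower a (- Rabs (y - 1))).
    pose (C := Rabs y * (Rabs (y - 1) * Rpower a (- Rabs (y - 1 - 1)))).
    assert (0 <= A) by (left; apply Rpower_pos).
    assert (0 <= B) by (apply Rmult_le_pos; [apply Rabs_pos|left; apply Rpower_pos]).
    assert (0 <= C) by (repeat apply Rmult_le_pos; try apply Rabs_pos; left; apply Rpower_pos).
    exists (K + A + B + C). split; [lra|].
    intros z x [<-|Hz] Hx.
    + rewrite !Rabs_mult. rewrite !(fun w => Rabs_right _ (Rle_ge _ _ (Rlt_le _ _ (Rpower_pos x w)))).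
      pose proof (Rabs_pos y). pose proof (Rabs_pos (y - 1)).
      assert (Rpower x y <= A) by (apply Rpower_le_base; lra).
      assert (Rabs y * Rpower x (y - 1) <= B).
      { apply Rmult_le_compat_l; auto. apply Rpower_le_base; lra. }
      assert (Rabs y * (Rabs (y - 1) * Rpower x (y - 1 - 1)) <= C).
      { repeat apply Rmult_le_compat_l; auto. apply Rpower_le_base; lra. }
      lra.
    + destruct (IH z x Hz Hx) as [? [? ?]]. lra.
Qed.

(** The slope is at most |c| exp(-c^2/2) <= |c| / (1 + c^2/2) <= 1. *)
Lemma gauss_density_lip a b : Rabs (gauss_density a - gauss_density b) <= Rabs (a - b).
Proof.
  destruct (MVT_gen gauss_density b a (fun t => - t * gauss_density t)) as [c [_ E]].
  - intros x _. apply is_derive_gauss_density.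
  - intros x _. apply continuity_pt_filterlim, continuous_gauss_density.
  - rewrite E Rabs_mult. rewrite <- (Rmult_1_l (Rabs (a - b))) at 2.
    apply Rmult_le_compat_r; [apply Rabs_pos|].
    rewrite Rabs_mult Rabs_Ropp (Rabs_right (gauss_density c));
      [|left; apply gauss_density_pos].
    pose proof (gauss_density_le c) as H. pose proof (exp_ineq1_le (c ^ 2 / 2)) as H1.
    replace (- c ^ 2 / 2) with (- (c ^ 2 / 2)) in H by field. rewrite exp_Ropp in H.
    pose proof (exp_pos (c ^ 2 / 2)) as H2. pose proof (pow2_abs c). pose proof (Rabs_pos c).
    apply Rle_trans with (Rabs c * / exp (c ^ 2 / 2)); [now apply Rmult_le_compat_l|].
    apply Rmult_le_reg_r with (exp (c ^ 2 / 2)); auto.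
    rewrite Rmult_assoc Rinv_l; [|lra]. nra.
Qed.

Lemma kac_diff a b a' b' : Rabs (Rabs b * gauss_density a - Rabs b' * gauss_density a')
  <= Rabs (b - b') + Rabs b' * Rabs (a - a').
Proof.
  replace (Rabs b * gauss_density a - Rabs b' * gauss_density a') with
    ((Rabs b - Rabs b') * gauss_density a + Rabs b' * (gauss_density a - gauss_density a')) by ring.
  eapply Rle_trans; [apply Rabs_triang|]. rewrite (Rabs_mult (Rabs b')) Rabs_Rabsolu (Rabs_mult (Rabs b - Rabs b')).
  pose proof (Rabs_triang_inv2 b b'). pose proof (gauss_density_lip a a').
  pose proof (gauss_density_pos a). pose proof (gauss_density_le_1 a).
  rewrite (Rabs_right (gauss_density a)); [|lra].
  pose proof (Rabs_pos b'). pose proof (Rabs_pos (Rabs b - Rabs b')).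
  apply Rplus_le_compat; [nra|]. now apply Rmult_le_compat_l.
Qed.

Lemma MVT_abs (f df : R -> R) a b K : 0 < a -> a <= b -> (forall x, 0 < x -> is_derive f x (df x)) ->
  (forall x, a <= x <= b -> Rabs (df x) <= K) -> Rabs (f b - f a) <= K * (b - a).
Proof.
  intros Ha Hab Hf HK. destruct (Rle_lt_or_eq_dec a b Hab) as [L|<-].
  - destruct (MVT_pos f df a b Ha L Hf) as [c [Hc ->]]. rewrite Rabs_mult (Rabs_right (b - a)); [|lra].
    apply Rmult_le_compat_r; [lra|auto].
  - rewrite !Rminus_diag Rabs_R0. lra.
Qed.

(** * Bounds on the integrand that are uniform in the coefficients *)

Definition kacT (Z T : list R) : R -> R := kac (level Z T) (dlevel Z T).

Definition bounded_coefs (M : R) (T : list R) : Prop := forall t, In t T -> Rabs t <= M.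

Lemma level_bounds Z M a : 0 <= M -> 0 < a <= 1 -> exists K, 0 <= K /\
  forall T x, length T = length Z -> bounded_coefs M T -> a <= x <= 1 ->
  Rabs (level Z T x) <= K /\ Rabs (dlevel Z T x) <= K /\ Rabs (ddlevel Z T x) <= K.
Proof.
  intros HM Ha. destruct (powers_bound Z a Ha) as [K [HK HB]].
  exists (INR (length Z) * (M * K)). split.
  { pose proof (pos_INR (length Z)). apply Rmult_le_pos; auto. nra. }
  intros T x HT HbT Hx. rewrite <- HT. unfold level, dlevel, ddlevel. rewrite !Rabs_Ropp.
  repeat split; apply dot_bound; auto; intros t z Hin; right;
    (split; [apply HbT; now apply in_combine_l in Hin|]);
    apply in_combine_r in Hin; now apply HB.
Qed.

(** K depends on the box of coefficients and on a, but not on T, so that a single mesh serves the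
    whole box. *)
Lemma kac_lip_x Z M a : 0 <= M -> 0 < a <= 1 -> exists K, 0 <= K /\
  forall T x y, length T = length Z -> bounded_coefs M T -> a <= x -> x <= y -> y <= 1 ->
  Rabs (kacT Z T y - kacT Z T x) <= K * (y - x).
Proof.
  intros HM Ha. destruct (level_bounds Z M a HM Ha) as [K [HK HB]].
  exists (K + K * K). split; [nra|]. intros T x y HT HbT Hx Hxy Hy.
  unfold kacT, kac. eapply Rle_trans; [apply kac_diff|].
  assert (Rabs (level Z T y - level Z T x) <= K * (y - x)) as H1.
  { apply MVT_abs with (dlevel Z T); [lra|auto|apply is_derive_level|].
    intros u Hu. apply HB; auto; lra. }
  assert (Rabs (dlevel Z T y - dlevel Z T x) <= K * (y - x)) as H2.
  { apply MVT_abs with (ddlevel Z T); [lra|auto|apply is_derive_dlevel|].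
    intros u Hu. apply HB; auto; lra. }
  destruct (HB T x HT HbT ltac:(lra)) as [_ [H3 _]].
  assert (Rabs (dlevel Z T x) * Rabs (level Z T y - level Z T x) <= K * (K * (y - x))).
  { apply Rmult_le_compat; auto; apply Rabs_pos. }
  lra.
Qed.

Lemma kac_lip_T Z M a : 0 <= M -> 0 < a <= 1 -> exists K, 0 <= K /\
  forall T T' x e, length T = length Z -> bounded_coefs M T' -> 0 <= e ->
  Forall2 (fun t t' => Rabs (t - t') <= e) T T' -> a <= x <= 1 ->
  Rabs (kacT Z T x - kacT Z T' x) <= K * e.
Proof.
  intros HM Ha. destruct (level_bounds Z M a HM Ha) as [K [HK HB]].
  destruct (powers_bound Z a Ha) as [Q [HQ HQB]].
  pose (n := INR (length Z)). assert (0 <= n) by apply pos_INR.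
  exists (n * Q + K * (n * Q)). split; [assert (0 <= n * Q) by nra; nra|].
  intros T T' x e HT HbT He HTT Hx.
  unfold kacT, kac. eapply Rle_trans; [apply kac_diff|].
  assert (Rabs (level Z T x - level Z T' x) <= n * (e * Q)) as H1.
  { unfold level. replace (- _ - - _) with (- (dot T (map (Rpower x) Z) - dot T' (map (Rpower x) Z))) by ring.
    rewrite Rabs_Ropp. unfold n. rewrite <- HT. apply dot_diff_bound; auto.
    intros z Hz. now apply HQB. }
  assert (Rabs (dlevel Z T x - dlevel Z T' x) <= n * (e * Q)) as H2.
  { unfold dlevel. set (g := fun z => z * Rpower x (z - 1)).
    replace (- _ - - _) with (- (dot T (map g Z) - dot T' (map g Z))) by ring.
    rewrite Rabs_Ropp. unfold n. rewrite <- HT. apply dot_diff_bound; auto.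
    intros z Hz. now apply HQB. }
  assert (length T' = length Z) as HT' by (rewrite <- HT; symmetry; eapply Forall2_length; eauto).
  destruct (HB T' x HT' HbT ltac:(lra)) as [_ [H3 _]].
  assert (Rabs (dlevel Z T' x) * Rabs (level Z T x - level Z T' x) <= K * (n * (e * Q))).
  { apply Rmult_le_compat; auto; apply Rabs_pos. }
  lra.
Qed.

Fixpoint left_sum (q : R -> R) (a D : R) (N : nat) : R :=
  match N with
  | O => 0
  | S N' => left_sum q a D N' + D * q (a + INR N' * D)
  end.

Lemma left_sum_error (q : R -> R) a D K N : 0 <= D -> 0 <= K ->
  (forall x y, a <= x -> x <= y -> y <= a + INR N * D -> Rabs (q y - q x) <= K * (y - x)) ->
  (forall x y, a <= x -> x <= y -> ex_RInt q x y) ->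
  Rabs (RInt q a (a + INR N * D) - left_sum q a D N) <= INR N * (K * D ^ 2).
Proof.
  intros HD HK. induction N as [|N IH]; intros Hq Hex.
  - simpl. rewrite Rmult_0_l Rplus_0_r.
    replace (RInt q a a) with 0 by (symmetry; exact (RInt_point a q)).
    rewrite Rminus_diag Rabs_R0. lra.
  - pose proof (pos_INR N). cbn [left_sum]. rewrite S_INR in Hq |- *.
    pose (c := a + INR N * D). replace (a + (INR N + 1) * D) with (c + D) in * by (unfold c; ring).
    assert (a <= c) by (unfold c; nra).
    rewrite (RInt_split q a c (c + D)); try (apply Hex; lra).
    assert (Rabs (RInt q a c - left_sum q a D N) <= INR N * (K * D ^ 2)) as H1.
    { apply IH; auto. intros x y Hx Hxy Hy. apply Hq; auto. fold c in Hy. lra. }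
    assert (Rabs (RInt q c (c + D) - D * q c) <= K * D ^ 2) as H2.
    { replace (RInt q c (c + D) - D * q c) with (RInt (fun x => minus (q x) (q c)) c (c + D)).
      - replace (K * D ^ 2) with ((c + D - c) * (K * D)) by ring.
        apply: abs_RInt_le_const; [lra| |].
        + apply: ex_RInt_minus; [apply Hex; lra|apply ex_RInt_const].
        + intros x Hx. apply Rle_trans with (1 := Hq c x ltac:(lra) ltac:(lra) ltac:(lra)).
          apply Rmult_le_compat_l; lra.
      - rewrite RInt_minus; [|apply Hex; lra|apply ex_RInt_const].
        rewrite RInt_const. unfold minus, plus, opp, scal; simpl. unfold mult; simpl. ring. }
    fold c. replace (RInt q a c + RInt q c (c + D) - (left_sum q a D N + D * q c)) with
      ((RInt q a c - left_sum q a D N) + (RInt q c (c + D) - D * q c)) by ring.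
    eapply Rle_trans; [apply Rabs_triang|]. lra.
Qed.

Lemma left_sum_diff q q' a D N e : 0 <= D ->
  (forall x, a <= x <= a + INR N * D -> Rabs (q x - q' x) <= e) ->
  Rabs (left_sum q a D N - left_sum q' a D N) <= INR N * D * e.
Proof.
  intros HD. induction N as [|N IH]; intros H.
  - simpl. rewrite Rminus_diag Rabs_R0. lra.
  - cbn [left_sum]. rewrite S_INR in H |- *. pose proof (pos_INR N).
    replace (left_sum q a D N + D * q (a + INR N * D) - (left_sum q' a D N + D * q' (a + INR N * D)))
      with ((left_sum q a D N - left_sum q' a D N) + D * (q (a + INR N * D) - q' (a + INR N * D))) by ring.
    eapply Rle_trans; [apply Rabs_triang|]. rewrite (Rabs_mult D) (Rabs_right D); [|lra].
    assert (Rabs (left_sum q a D N - left_sum q' a D N) <= INR N * D * e).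
    { apply IH. intros x Hx. apply H. nra. }
    assert (D * Rabs (q (a + INR N * D) - q' (a + INR N * D)) <= D * e); [|lra].
    apply Rmult_le_compat_l; auto. apply H. nra.
Qed.

(** * The integrand near 0 *)

Definition on_stratum (d M : R) (T : list R) : Prop := forall t, In t T -> t = 0 \/ in_box d M t.

(** What integrality leaves to the differences e_i - e_k: gaps of at least 1 between one another,
    and from the value 0 that belongs to the last exponent. *)
Definition unit_separated (Z : list R) : Prop :=
  NoDup Z /\ (forall z, In z Z -> 1 <= Rabs z) /\
  forall y z, In y Z -> In z Z -> y < z -> y + 1 <= z.

Lemma min_active (T Z : list R) : (forall t z, In (t, z) (combine T Z) -> t = 0) \/
  exists m, (exists t, t <> 0 /\ In (t, m) (combine T Z)) /\
    forall t z, In (t, z) (combine T Z) -> t <> 0 -> m <= z.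
Proof.
  induction (combine T Z) as [|[t z] l IH]; [left; intros ? ? []|].
  destruct (Req_dec t 0) as [->|Ht].
  - destruct IH as [IH|[m [[s [Hs Hin]] Hm]]].
    + left. intros s y [E|Hy]; [congruence|eauto].
    + right. exists m. split; [exists s; split; auto; now right|].
      intros u y [E|Hy] Hu; [congruence|eauto].
  - right. destruct IH as [IH|[m [[s [Hs Hin]] Hm]]].
    + exists z. split; [exists t; split; auto; now left|].
      intros u y [E|Hy] Hu; [injection E as _ <-; lra|]. now contradiction (Hu (IH u y Hy)).
    + exists (Rmin z m). split.
      * destruct (Rle_dec z m) as [L|L].
        -- rewrite Rmin_left //. exists t. split; auto; now left.
        -- rewrite Rmin_right; [|lra]. exists s. split; auto; now right.
      * intros u y [E|Hy] Hu; [injection E as _ <-; apply Rmin_l|].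
        apply Rle_trans with (1 := Rmin_r z m). eauto.
Qed.

(** After division by x^m the leading term is at least d in absolute value, and the unit gap makes
    every other term at most M x. *)
Lemma dot_leading_lower (d M : R) T : forall Z m x, 0 <= M -> NoDup Z -> 0 < x <= 1 ->
  (exists t, t <> 0 /\ In (t, m) (combine T Z)) ->
  (forall t z, In (t, z) (combine T Z) -> t = 0 \/ (in_box d M t /\ (z = m \/ m + 1 <= z))) ->
  d - INR (length T) * (M * x) <= Rabs (dot T (map (fun z => Rpower x (z - m)) Z)).
Proof.
  induction T as [|t T IH]; intros [|z Z] m x HM HN Hx [s [Hs Hin]] H; try now destruct Hin.
  cbn [dot map combine length] in *. inversion_clear HN. rewrite S_INR.
  assert (0 <= M * x) by nra. pose proof (pos_INR (length T)).
  assert (forall u y, In (u, y) (combine T Z) -> u = 0 \/ (in_box d M u /\ (y = m \/ m + 1 <= y))) as H'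
    by (intros; apply H; now right).
  destruct Hin as [E|Hin].
  - injection E as -> ->. rewrite Rminus_diag Rpower_O; [|lra].
    destruct (H s m (or_introl eq_refl)) as [|[[Hb _] _]]; [contradiction|].
    assert (Rabs (dot T (map (fun z => Rpower x (z - m)) Z)) <= INR (length T) * (M * x)) as Hd.
    { apply dot_bound; auto; [lra|]. intros u y Hu. destruct (H' u y Hu) as [|[[_ Hub] Hy]]; [now left|].
      right. split; auto. destruct Hy as [->|Hy].
      - apply in_combine_r in Hu. contradiction.
      - rewrite Rabs_right; [|left; apply Rpower_pos]. rewrite <- (Rpower_1 x) at 2; [|lra].
        apply Rpower_antitone; lra. }
    pose proof (Rabs_triang_inv (s * 1) (- dot T (map (fun z => Rpower x (z - m)) Z))) as K.
    rewrite Rabs_Ropp Rmult_1_r in K.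
    replace (s - - dot T (map (fun z => Rpower x (z - m)) Z)) with
      (s * 1 + dot T (map (fun z => Rpower x (z - m)) Z)) in K by ring. lra.
  - assert (d - INR (length T) * (M * x) <= Rabs (dot T (map (fun z => Rpower x (z - m)) Z))) as K.
    { apply IH; auto. now exists s. }
    assert (Rabs (t * Rpower x (z - m)) <= M * x) as K2.
    { destruct (H t z (or_introl eq_refl)) as [->|[[_ Hb] [->|Hz]]].
      - rewrite Rmult_0_l Rabs_R0. assumption.
      - apply in_combine_r in Hin. contradiction.
      - rewrite Rabs_mult (Rabs_right (Rpower x (z - m))); [|left; apply Rpower_pos].
        apply Rmult_le_compat; auto; [apply Rabs_pos|left; apply Rpower_pos|].
        rewrite <- (Rpower_1 x) at 2; [|lra]. apply Rpower_antitone; lra. }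
    pose proof (Rabs_triang_inv (dot T (map (fun z => Rpower x (z - m)) Z)) (- (t * Rpower x (z - m)))) as K3.
    rewrite Rabs_Ropp in K3.
    replace (dot T (map (fun z => Rpower x (z - m)) Z) - - (t * Rpower x (z - m))) with
      (t * Rpower x (z - m) + dot T (map (fun z => Rpower x (z - m)) Z)) in K3 by ring. lra.
Qed.

Lemma list_abs_bound (Z : list R) : exists K, 0 <= K /\ forall z, In z Z -> Rabs z <= K.
Proof.
  induction Z as [|y Z [K [HK IH]]]; [exists 0; split; [lra|intros z []]|].
  exists (Rabs y + K). pose proof (Rabs_pos y). split; [lra|].
  intros z [<-|Hz]; [lra|]. specialize (IH z Hz). lra.
Qed.

(* If the dominant exponent [m] at [0] is negative, [|level|] is of order [x^m], and the
   Gaussian factor beats the blow-up of [dlevel]; otherwise [dlevel] is itself bounded. *)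
Lemma kac_bounded_near_0 Z d M : unit_separated Z -> 0 < d -> 0 <= M -> exists a C, 0 < a <= 1 /\ 0 <= C /\
  forall T x, length T = length Z -> on_stratum d M T -> 0 < x <= a -> kacT Z T x <= C.
Proof.
  intros [HN [H1 Hsep]] Hd HM. destruct (list_abs_bound Z) as [Q [HQ HQB]].
  pose (n := INR (length Z)). assert (0 <= n) as Hn by apply pos_INR.
  assert (0 <= M * Q) by nra. assert (0 <= n * (M * Q)) by nra.
  assert (0 < 8 / d ^ 2) by (apply Rdiv_lt_0_compat; nra).
  assert (0 <= n * M) by nra.
  (* For x below this threshold the lower-order terms total at most d / 2, so the leading term keeps
     half of its size. *)
  exists (Rmin 1 (d / (2 * (n * M + 1)))), (n * (M * Q) * (1 + 8 / d ^ 2)).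
  assert (0 < d / (2 * (n * M + 1))) by (apply Rdiv_lt_0_compat; lra).
  pose proof (Rmin_l 1 (d / (2 * (n * M + 1)))). pose proof (Rmin_r 1 (d / (2 * (n * M + 1)))).
  split; [split; [apply Rmin_pos; lra|lra]|]. split; [nra|].
  intros T x HT HS Hx. unfold kacT, kac.
  pose proof (gauss_density_pos (level Z T x)). pose proof (gauss_density_le_1 (level Z T x)).
  destruct (min_active T Z) as [Hz|[m [Hm Hmin]]].
  { assert (Rabs (dlevel Z T x) <= INR (length T) * (M * 0)) as E.
    { unfold dlevel. rewrite Rabs_Ropp. apply dot_bound; auto; [lra|]. intros; left; eauto. }
    rewrite Rmult_0_r Rmult_0_r in E. pose proof (Rabs_pos (dlevel Z T x)).
    assert (Rabs (dlevel Z T x) = 0) as -> by lra. rewrite Rmult_0_l. nra. }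
  assert (forall t z, In (t, z) (combine T Z) -> t = 0 \/ in_box d M t) as HS'.
  { intros t z Hin. apply HS. now apply in_combine_l in Hin. }
  pose proof (Rpower_pos x (m - 1)) as Hpm.
  assert (Rabs (dlevel Z T x) <= n * (M * Q) * Rpower x (m - 1)) as HD.
  { unfold dlevel. rewrite Rabs_Ropp. unfold n. rewrite <- HT.
    rewrite Rmult_assoc Rmult_assoc. apply dot_bound; auto; [nra|].
    intros t z Hin. destruct (Req_dec t 0) as [|Ht]; [now left|right].
    destruct (HS' t z Hin) as [|[_ ?]]; [contradiction|]. split; auto.
    rewrite Rabs_mult (Rabs_right (Rpower x (z - 1))); [|left; apply Rpower_pos].
    apply Rmult_le_compat; [apply Rabs_pos|left; apply Rpower_pos| |].
    - apply HQB. now apply in_combine_r in Hin.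
    - apply Rpower_antitone; [lra|]. specialize (Hmin t z Hin Ht). lra. }
  assert (In m Z) as HmZ by (destruct Hm as [t [_ Hin]]; now apply in_combine_r in Hin).
  pose proof (H1 m HmZ) as Hm1. pose proof (Rabs_pos (dlevel Z T x)).
  destruct (Rle_dec 0 m) as [Hm0|Hm0].
  { rewrite Rabs_right in Hm1; [|lra].
    assert (Rpower x (m - 1) <= 1) by (apply Rpower_le_1; lra).
    apply Rle_trans with (n * (M * Q) * 1 * 1); [|nra].
    apply Rmult_le_compat; auto; try lra.
    apply Rle_trans with (1 := HD). apply Rmult_le_compat_l; lra. }
  rewrite Rabs_left in Hm1; [|lra].
  pose proof (Rpower_pos x m) as Pm.
  assert (d / 2 * Rpower x m <= Rabs (level Z T x)) as HL.
  { assert (d - INR (length T) * (M * x) <= Rabs (dot T (map (fun z => Rpower x (z - m)) Z))) as K.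
    { apply dot_leading_lower; auto; [lra|]. intros t z Hin.
      destruct (Req_dec t 0) as [|Ht]; [now left|right].
      destruct (HS' t z Hin) as [|Hb]; [contradiction|]. split; auto.
      destruct (Hmin t z Hin Ht) as [L|E]; [right|now left].
      apply Hsep; auto. now apply in_combine_r in Hin. }
    rewrite dot_map_shift in K; [|lra]. rewrite HT in K. fold n in K.
    assert (n * (M * x) <= d / 2).
    { apply Rle_trans with ((n * M + 1) * (d / (2 * (n * M + 1)))); [|right; field; lra].
      rewrite <- Rmult_assoc. apply Rmult_le_compat; lra. }
    unfold level. rewrite Rabs_Ropp. rewrite Rabs_mult in K.
    rewrite (Rabs_right (Rpower x (- m))) in K; [|left; apply Rpower_pos].
    apply Rmult_le_reg_l with (Rpower x (- m)); [apply Rpower_pos|].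
    replace (Rpower x (- m) * (d / 2 * Rpower x m)) with (d / 2 * (Rpower x (- m) * Rpower x m)) by ring.
    rewrite <- Rpower_plus. replace (- m + m) with 0 by ring. rewrite Rpower_O; lra. }
  assert (0 < d / 2 * Rpower x m) as P0 by nra.
  assert (gauss_density (level Z T x) * (level Z T x) ^ 2 <= 2) as HG.
  { pose proof (gauss_density_le (level Z T x)) as H'. pose proof (exp_ineq1_le (level Z T x ^ 2 / 2)) as H''.
    replace (- level Z T x ^ 2 / 2) with (- (level Z T x ^ 2 / 2)) in H' by field. rewrite exp_Ropp in H'.
    pose proof (exp_pos (level Z T x ^ 2 / 2)) as H2'.
    assert (0 <= level Z T x ^ 2) by nra.
    apply Rle_trans with (/ exp (level Z T x ^ 2 / 2) * level Z T x ^ 2); [now apply Rmult_le_compat_r|].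
    apply Rmult_le_reg_l with (exp (level Z T x ^ 2 / 2)); auto.
    rewrite <- Rmult_assoc, Rinv_r; lra. }
  assert (gauss_density (level Z T x) <= 8 / d ^ 2 * / (Rpower x m) ^ 2) as HG2.
  { apply Rmult_le_reg_r with ((d / 2 * Rpower x m) ^ 2); [nra|].
    replace (8 / d ^ 2 * / Rpower x m ^ 2 * (d / 2 * Rpower x m) ^ 2) with 2 by (field; lra).
    apply Rle_trans with (2 := HG). apply Rmult_le_compat_l; [lra|].
    rewrite <- (pow2_abs (level Z T x)). apply pow_incr. lra. }
  apply Rle_trans with (n * (M * Q) * Rpower x (m - 1) * (8 / d ^ 2 * / Rpower x m ^ 2)).
  { apply Rmult_le_compat; lra. }
  replace (n * (M * Q) * Rpower x (m - 1) * (8 / d ^ 2 * / Rpower x m ^ 2)) with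
    (n * (M * Q) * (8 / d ^ 2) * (Rpower x (m - 1) * / Rpower x m ^ 2)) by ring.
  (* The remaining exponent is (m - 1) - 2 m = -m - 1, which is nonnegative because m <= -1. *)
  assert (Rpower x (m - 1) * / Rpower x m ^ 2 <= 1) as HP.
  { apply Rmult_le_reg_r with (Rpower x m ^ 2); [nra|].
    rewrite Rmult_assoc Rinv_l; [|nra]. rewrite Rmult_1_r Rmult_1_l. simpl. rewrite Rmult_1_r.
    rewrite <- Rpower_plus. apply Rpower_antitone; lra. }
  assert (0 <= n * (M * Q) * (8 / d ^ 2)) by nra. nra.
Qed.

Lemma kac_integral_near Z T r a C V : 0 < a < r -> 0 <= C ->
  (forall x, 0 < x <= a -> kacT Z T x <= C) -> kac_integral (level Z T) (dlevel Z T) 0 r V ->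
  RInt (kacT Z T) a r <= V <= RInt (kacT Z T) a r + C * a.
Proof.
  intros Ha HC HK [Hub Hlub]. pose proof (C1_pos_level Z T) as HC1. split.
  - apply Hub. exists a. split; [lra|reflexivity].
  - apply Hlub. intros y [b [Hb ->]]. fold (kacT Z T).
    assert (0 <= C * a) by nra.
    destruct (Rle_dec a b) as [Hab|Hab].
    + rewrite (RInt_split (kacT Z T) a b r); try (apply kac_ex_RInt; auto; lra).
      pose proof (kac_RInt_nonneg _ _ a b HC1 ltac:(lra) Hab). unfold kacT. lra.
    + rewrite (RInt_split (kacT Z T) b a r); try (apply kac_ex_RInt; auto; lra).
      assert (RInt (kacT Z T) b a <= RInt (fun _ => C) b a).
      { apply RInt_le; [lra|apply kac_ex_RInt; auto; lra|apply ex_RInt_const|].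
        intros x Hx. apply HK. lra. }
      rewrite RInt_const in H0. unfold scal in H0; simpl in H0; unfold mult in H0; simpl in H0.
      assert ((a - b) * C <= C * a) by nra. lra.
Qed.

(** The nodes are fixed before T, which lets the expectation be estimated node by node later. Half
    of e pays for (0, a], where the integrand is bounded, and half for the mesh on [a, r]. *)
Lemma kac_integral_approx Z d M r e : unit_separated Z -> 0 < d -> 0 < r < 1 -> 0 < e ->
  exists a D N, 0 < a /\ 0 < D /\ a + INR N * D = r /\
  forall T V, length T = length Z -> on_stratum d M T ->
    kac_integral (level Z T) (dlevel Z T) 0 r V ->
    Rabs (V - left_sum (kacT Z T) a D N) <= e.
Proof.
  intros HZ Hd Hr He. pose (M' := Rabs M). assert (0 <= M') as HM by apply Rabs_pos.
  assert (forall T, on_stratum d M T -> on_stratum d M' T) as HS.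
  { intros T HT t Ht. destruct (HT t Ht) as [|[? ?]]; [now left|right].
    split; auto. pose proof (Rle_abs M). unfold M'. lra. }
  destruct (kac_bounded_near_0 Z d M' HZ Hd HM) as [a0 [C [Ha0 [HC HB]]]].
  pose (a := Rmin (Rmin a0 (r / 2)) (e / (2 * (C + 1)))).
  assert (0 < e / (2 * (C + 1))) by (apply Rdiv_lt_0_compat; lra).
  assert (0 < a) as Ha by (repeat apply Rmin_pos; lra).
  assert (a <= Rmin a0 (r / 2)) as Ha1 by apply Rmin_l.
  pose proof (Rmin_l a0 (r / 2)). pose proof (Rmin_r a0 (r / 2)).
  assert (a <= e / (2 * (C + 1))) as Ha2 by apply Rmin_r.
  assert (C * a <= e / 2) as HCa.
  { apply Rle_trans with ((C + 1) * (e / (2 * (C + 1)))); [|right; field; lra].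
    apply Rmult_le_compat; lra. }
  destruct (kac_lip_x Z M' a HM ltac:(lra)) as [K [HK HL]].
  (* The mesh error is K (r - a)^2 / N <= K / N <= e / 2; the + 1 keeps N positive when K = 0. *)
  destruct (INR_unbounded (2 * K / e + 1)) as [N HN].
  assert (0 <= 2 * K / e) by (apply Rdiv_le_0_compat; lra).
  exists a, ((r - a) / INR N), N.
  assert (a + INR N * ((r - a) / INR N) = r) as Er by (field; lra).
  assert (0 < (r - a) / INR N) as HD by (apply Rdiv_lt_0_compat; lra).
  repeat split; auto. intros T V HT HST HV.
  assert (bounded_coefs M' T) as HbT.
  { intros t Ht. destruct (HS T HST t Ht) as [->|[_ ?]]; auto. rewrite Rabs_R0. auto. }
  pose proof (kac_integral_near Z T r a C V ltac:(lra) HC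
    ltac:(intros x Hx; apply HB; auto; lra) HV) as HVa.
  assert (Rabs (RInt (kacT Z T) a r - left_sum (kacT Z T) a ((r - a) / INR N) N) <= e / 2) as HE.
  { pose proof (left_sum_error (kacT Z T) a ((r - a) / INR N) K N ltac:(lra) HK) as E.
    rewrite Er in E. eapply Rle_trans; [apply E|].
    - intros x y Hx Hxy Hy. apply HL; auto; lra.
    - intros x y Hx Hxy. apply kac_ex_RInt; auto; [apply C1_pos_level|lra].
    - replace (INR N * (K * ((r - a) / INR N) ^ 2)) with (K * (r - a) ^ 2 / INR N) by (field; lra).
      apply Rmult_le_reg_r with (INR N); [lra|].
      replace (K * (r - a) ^ 2 / INR N * INR N) with (K * (r - a) ^ 2) by (field; lra).
      assert ((r - a) ^ 2 <= 1) by nra.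
      apply Rle_trans with K; [nra|].
      replace K with (e / 2 * (2 * K / e)) at 1 by (field; lra). apply Rmult_le_compat_l; lra. }
  apply Rabs_le_between in HE. apply Rabs_le. lra.
Qed.

(** On each stratum the integral is a uniform limit of finite sums that are Lipschitz in T: an e / 3
    argument. *)
Lemma stratified_kac_integral Z r B (V : list R -> R) : unit_separated Z -> 0 < r < 1 ->
  (forall T, length T = length Z -> 0 <= V T <= B /\ kac_integral (level Z T) (dlevel Z T) 0 r (V T)) ->
  stratified (length Z) B V.
Proof.
  intros HZ Hr HV. split; [intros T HT; now apply HV|]. intros d M e Hd He.
  destruct (kac_integral_approx Z d M r (e / 3) HZ Hd Hr ltac:(lra)) as [a [D [N [Ha [HD [Er HA]]]]]].
  pose proof (pos_INR N). assert (0 <= INR N * D) by nra.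
  destruct (kac_lip_T Z (Rabs M) a (Rabs_pos M) ltac:(lra)) as [K [HK HL]].
  pose (h := e / (3 * (K + 1))). assert (0 < h) as Hh by (apply Rdiv_lt_0_compat; lra).
  exists h. split; auto. intros T T' HT HTT.
  assert (length T' = length Z) as HT' by (rewrite <- HT; symmetry; eapply Forall2_length; eauto).
  assert (on_stratum d M T /\ on_stratum d M T' /\ Forall2 (fun t t' => Rabs (t - t') <= h) T T')
    as [S1 [S2 S3]].
  { clear - HTT Hh. induction HTT as [|t t' T T' Ht HTT [I1 [I2 I3]]].
    - repeat split; try (intros t []). constructor.
    - repeat split.
      + intros u [<-|Hu]; auto. destruct Ht as [[-> _]|[? _]]; auto.
      + intros u [<-|Hu]; auto. destruct Ht as [[_ ->]|[_ [? _]]]; auto.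
      + constructor; auto. destruct Ht as [[-> ->]|[_ [_ ?]]]; auto.
        rewrite Rminus_diag Rabs_R0. lra. }
  destruct (HV T HT) as [_ V1]. destruct (HV T' HT') as [_ V2].
  pose proof (HA T (V T) HT S1 V1) as A1. pose proof (HA T' (V T') HT' S2 V2) as A2.
  assert (Rabs (left_sum (kacT Z T) a D N - left_sum (kacT Z T') a D N) <= INR N * D * (K * h)) as A3.
  { apply left_sum_diff; [lra|]. intros x Hx. apply HL; auto; [|lra|lra].
    intros t Ht. destruct (S2 t Ht) as [->|[_ Hb]].
    - rewrite Rabs_R0. apply Rabs_pos.
    - apply Rle_trans with (1 := Hb). apply Rle_abs. }
  assert (INR N * D * (K * h) <= e / 3).
  { apply Rle_trans with (1 * (K * h)).
    - apply Rmult_le_compat_r; [nra|lra].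
    - unfold h. apply Rmult_le_reg_r with (3 * (K + 1)); [lra|].
      replace (1 * (K * (e / (3 * (K + 1)))) * (3 * (K + 1))) with (K * e) by (field; lra). nra. }
  apply Rabs_le_between in A1. apply Rabs_le_between in A2. apply Rabs_le_between in A3.
  apply Rabs_le. lra.
Qed.

(** * The Gaussian bound at a point *)

Lemma dot_self_nonneg L : 0 <= dot L L.
Proof. induction L as [|l L IH]; simpl; [lra|nra]. Qed.

(* Integrate out one coordinate at a time, completing the square. *)
Lemma gauss_exp_tilted n : forall al be A b0 c0, length al = n -> length be = n ->
  gauss_exp n (fun T => (A + (b0 + dot T be) ^ 2) * exp (- (c0 + dot T al) ^ 2 / 2))
    ((A + (b0 - c0 * dot al be / (1 + dot al al)) ^ 2 + dot be be - dot al be ^ 2 / (1 + dot al al))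
      * exp (- c0 ^ 2 / (2 * (1 + dot al al))) / sqrt (1 + dot al al)).
Proof.
  induction n as [|n IH]; intros al be A b0 c0 Ha Hb.
  - destruct al; [|easy]. destruct be; [|easy]. simpl.
    rewrite !Rplus_0_r sqrt_1. simpl.
    replace (- (c0 * (c0 * 1)) / (2 * 1)) with (- (c0 * (c0 * 1)) / 2) by field. field.
  - destruct al as [|a al]; [easy|]. destruct be as [|b be]; [easy|]. simpl in Ha, Hb.
    pose (s' := 1 + dot al al). pose (P := dot al be). pose (R0 := dot be be).
    pose proof (dot_self_nonneg al). assert (0 < s') as Hs' by (unfold s'; lra).
    pose (s := s' + a ^ 2). assert (0 < s) as Hs by (unfold s; nra).
    assert (0 < s' + a ^ 2) as Hs2 by exact Hs.
    (* The first coordinate only shifts the offsets b0 and c0, which is why the induction carries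
       them although the application has both equal to 0. *)
    exists (fun t => (A + (b0 + t * b - (c0 + t * a) * P / s') ^ 2 + R0 - P ^ 2 / s')
      * exp (- (c0 + t * a) ^ 2 / (2 * s')) / sqrt s'). split.
    + intros t. apply gauss_exp_ext with (2 := IH al be A (b0 + t * b) (c0 + t * a) ltac:(lia) ltac:(lia)).
      intros l _. simpl. f_equal; [f_equal; ring|]. f_equal. field.
    + cbn [dot]. replace (1 + (a * a + dot al al)) with s by (unfold s, s'; ring).
      fold P R0.
      (* From completing the square: (c0 + t a)^2 / s' + t^2 = k^2 (t + c0 a / s)^2 + c0^2 / s. *)
      pose (k := sqrt (s / s')). assert (0 < s / s') as Hss by (apply Rdiv_lt_0_compat; lra).
      assert (0 < k) as Hk by now apply sqrt_lt_R0.
      assert (k ^ 2 = s / s') as Hk2 by (unfold k; rewrite pow2_sqrt; lra).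
      assert (sqrt s' * k = sqrt s) as Hsk.
      { unfold k. rewrite <- sqrt_mult; try lra. f_equal. field. lra. }
      assert (0 < sqrt s') as Hq' by now apply sqrt_lt_R0.
      pose proof (improper_int_scal _ _ (exp (- c0 ^ 2 / (2 * s)) / sqrt s')
        (improper_int_quadratic_gauss (A + R0 - P ^ 2 / s') (b0 - c0 * P / s') (b - a * P / s') k
          (c0 * a / s) Hk)) as K.
      match type of K with improper_int _ ?v => match goal with |- improper_int _ ?w =>
        replace w with v end end.
      * apply improper_int_ext with (2 := K). intros t. cbv beta.
        assert (gauss_density (k * (t + c0 * a / s)) * exp (- c0 ^ 2 / (2 * s)) =
          exp (- (c0 + t * a) ^ 2 / (2 * s')) * gauss_density t) as E.
        { unfold gauss_density, Rdiv. rewrite !(Rmult_comm (exp _ * / sqrt (2 * PI))).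
          rewrite <- !Rmult_assoc, <- !exp_plus. f_equal. f_equal.
          rewrite Rpow_mult_distr Hk2. unfold s. field. repeat split; lra. }
        replace (b0 + t * b - (c0 + t * a) * P / s') with (b0 - c0 * P / s' + (b - a * P / s') * t)
          by (field; lra).
        transitivity ((A + R0 - P ^ 2 / s' + (b0 - c0 * P / s' + (b - a * P / s') * t) ^ 2) *
          (gauss_density (k * (t + c0 * a / s)) * exp (- c0 ^ 2 / (2 * s))) / sqrt s'); [field; lra|].
        rewrite E. field. lra.
      * rewrite Hk2. rewrite <- Hsk.
        set (X := exp _).
        replace (A + R0 - P ^ 2 / s' + (b0 - c0 * P / s' - (b - a * P / s') * (c0 * a / s)) ^ 2
          + (b - a * P / s') ^ 2 / (s / s')) with
          (A + (b0 - c0 * (a * b + P) / s) ^ 2 + (b * b + R0) - (a * b + P) ^ 2 / s).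
        { field. lra. }
        unfold s. field. repeat split; lra.
Qed.

(** * The variance of a random exponent *)

Fixpoint sumR (f : nat -> R) (l : list nat) : R :=
  match l with
  | nil => 0
  | e :: l' => f e + sumR f l'
  end.

Lemma sumR_app f l l' : sumR f (l ++ l') = sumR f l + sumR f l'.
Proof. induction l as [|e l IH]; simpl; [ring|rewrite IH; ring]. Qed.

Lemma sumR_scal c f l : sumR (fun e => c * f e) l = c * sumR f l.
Proof. induction l as [|e l IH]; simpl; [ring|rewrite IH; ring]. Qed.

Lemma sumR_ext f g l : (forall e, In e l -> f e = g e) -> sumR f l = sumR g l.
Proof.
  induction l as [|e l IH]; simpl; auto. intros H. rewrite IH; auto. rewrite H; auto.
Qed.

Lemma sumR_nonneg f l : (forall e, 0 <= f e) -> 0 <= sumR f l.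
Proof. intros H. induction l as [|e l IH]; simpl; [lra|]. specialize (H e). lra. Qed.

Lemma sumR_in f l e : (forall e, 0 <= f e) -> In e l -> f e <= sumR f l.
Proof.
  intros H. induction l as [|a l IH]; simpl; [easy|]. intros [->|Hi].
  - pose proof (sumR_nonneg f l H). lra.
  - specialize (IH Hi). specialize (H a). lra.
Qed.

Lemma sumR_map f (g : nat -> nat) l : sumR f (map g l) = sumR (fun e => f (g e)) l.
Proof. induction l as [|e l IH]; simpl; [reflexivity|now rewrite IH]. Qed.

Lemma sumR_incl f l : forall l', (forall e, 0 <= f e) -> NoDup l -> incl l l' -> sumR f l <= sumR f l'.
Proof.
  induction l as [|e l IH]; intros l' Hf HN Hi; [now apply sumR_nonneg|].
  inversion_clear HN. destruct (in_split e l') as [l1 [l2 ->]]; [apply Hi; now left|].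
  rewrite sumR_app. simpl.
  assert (sumR f l <= sumR f (l1 ++ l2)) as K; [|rewrite sumR_app in K; lra].
  apply IH; auto. intros a Ha. specialize (Hi a (or_intror Ha)).
  apply in_app_iff in Hi. apply in_app_iff. destruct Hi as [|[<-|]]; auto. contradiction.
Qed.

Lemma dot_map_map (f g : nat -> R) l : dot (map f l) (map g l) = sumR (fun e => f e * g e) l.
Proof. induction l as [|e l IH]; simpl; [reflexivity|now rewrite IH]. Qed.

Lemma sum_sqr_pow u N : u <> 1 -> sumR (fun n => INR n ^ 2 * u ^ n) (seq 0 (S N)) =
  u * ((1 + u) - u ^ N * (INR N ^ 2 * (1 - u) ^ 2 + 2 * INR N * (1 - u) + 1 + u)) / (1 - u) ^ 3.
Proof.
  intros Hu. induction N as [|N IH].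
  - simpl. field. lra.
  - rewrite seq_S sumR_app IH. cbn [Nat.add sumR]. rewrite S_INR. simpl pow. field. lra.
Qed.

(** Distinct exponents let the sum be completed to all n up to the maximum. The closed form of that
    finite sum is the value of the full series minus a nonnegative remainder, so no infinite series
    is needed. *)
Lemma sum_sqr_pow_le u l : 0 < u < 1 -> NoDup l ->
  sumR (fun n => INR n ^ 2 * u ^ n) l <= u * (1 + u) / (1 - u) ^ 3.
Proof.
  intros Hu HN.
  assert (forall e, 0 <= INR e ^ 2 * u ^ e) as Hpos.
  { intros e. apply Rmult_le_pos; [nra|apply pow_le; lra]. }
  apply Rle_trans with (sumR (fun n => INR n ^ 2 * u ^ n) (seq 0 (S (list_max l)))).
  - apply sumR_incl; auto. intros e He. apply in_seq.
    pose proof (proj1 (list_max_le l (list_max l)) (Nat.le_refl _)) as K.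
    rewrite Forall_forall in K. specialize (K e He). lia.
  - set (N := list_max l). rewrite sum_sqr_pow; [|lra].
    apply Rmult_le_compat_r; [left; apply Rinv_0_lt_compat, pow_lt; lra|].
    apply Rmult_le_compat_l; [lra|].
    pose proof (pow_le u N ltac:(lra)). pose proof (pos_INR N).
    assert (0 <= INR N ^ 2 * (1 - u) ^ 2 + 2 * INR N * (1 - u) + 1 + u); [|nra].
    pose proof (pow2_ge_0 (INR N * (1 - u))). nra.
Qed.

Lemma list_min_exists (l : list nat) : l <> nil -> exists m, In m l /\ forall e, In e l -> (m <= e)%nat.
Proof.
  induction l as [|a l IH]; [easy|]. intros _. destruct l as [|b l].
  - exists a. split; [now left|]. intros e [<-|[]]; lia.
  - destruct IH as [m [Hm Hle]]; [easy|]. destruct (Nat.le_gt_cases a m) as [L|L].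
    + exists a. split; [now left|]. intros e [<-|He]; [lia|]. specialize (Hle e He). lia.
    + exists m. split; [now right|]. intros e [<-|He]; [lia|auto].
Qed.

Lemma sumR_quadratic (X p : nat -> R) c l : sumR (fun e => (X e - c) ^ 2 * p e) l =
  sumR (fun e => X e ^ 2 * p e) l - 2 * c * sumR (fun e => X e * p e) l + c ^ 2 * sumR p l.
Proof. induction l as [|e l IH]; simpl in *; [ring|rewrite IH; ring]. Qed.

(* The left-hand side is the variance of the exponent under the weights [x^(2e)], divided
   by [x^2]; it is at most the second moment about the least exponent. *)
Lemma exponent_variance_le (s : list nat) (e0 : nat) x : NoDup (s ++ [e0]) -> 0 < x < 1 ->
  let Z := map (fun e => INR e - INR e0) s in
  let al := map (Rpower x) Z in
  let be := map (fun z => z * Rpower x (z - 1)) Z in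
  dot be be - dot al be ^ 2 / (1 + dot al al) <=
    (1 + dot al al) * ((1 + x ^ 2) / (1 - x ^ 2) ^ 3).
Proof.
  intros HN Hx Z al be. pose (s0 := s ++ [e0]).
  (* Relative to e0 the last exponent has weight 1 and value [X e0] = 0. It thus supplies the 1 in 1
     + [dot al al] and nothing to the other two sums. *)
  pose (p := fun e => Rpower x (INR e - INR e0) ^ 2). pose (X := fun e => (INR e - INR e0) / x).
  assert (forall e, 0 <= p e) as Hp by (intros; unfold p; nra).
  assert (p e0 = 1) as Hp0 by (unfold p; rewrite Rminus_diag Rpower_O; [ring|lra]).
  assert (1 + dot al al = sumR p s0) as E1.
  { unfold s0. rewrite sumR_app. cbn [sumR]. rewrite Hp0. unfold al, Z. rewrite map_map dot_map_map.
    rewrite (sumR_ext _ p); [ring|]. intros e _. unfold p. ring. }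
  assert (forall e, (INR e - INR e0) * Rpower x (INR e - INR e0 - 1) = X e * Rpower x (INR e - INR e0)) as EX.
  { intros e. unfold X. unfold Rminus at 2. rewrite Rpower_plus Rpower_Ropp Rpower_1; [|lra]. field. lra. }
  assert (X e0 = 0) as HX0 by (unfold X; field; lra).
  assert (dot al be = sumR (fun e => X e * p e) s0) as E2.
  { unfold s0. rewrite sumR_app. cbn [sumR]. rewrite HX0. unfold al, be, Z. rewrite !map_map dot_map_map.
    rewrite (sumR_ext _ (fun e => X e * p e)); [ring|]. intros e _. rewrite EX. unfold p. ring. }
  assert (dot be be = sumR (fun e => X e ^ 2 * p e) s0) as E3.
  { unfold s0. rewrite sumR_app. cbn [sumR]. rewrite HX0. unfold be, Z. rewrite !map_map dot_map_map.
    rewrite (sumR_ext _ (fun e => X e ^ 2 * p e)); [ring|]. intros e _. rewrite EX. unfold p. ring. }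
  rewrite E1 E2 E3.
  assert (0 < sumR p s0) as Hs by (rewrite <- E1; pose proof (dot_self_nonneg al); lra).
  destruct (list_min_exists s0) as [m [Hm Hmin]]; [unfold s0; now destruct s|].
  pose proof (sumR_quadratic X p (X m) s0) as Q.
  apply Rle_trans with (sumR (fun e => (X e - X m) ^ 2 * p e) s0).
  (* A second moment about any centre exceeds the one about the mean, the difference being (X m - S1
     / S0)^2 S0. *)
  { rewrite Q. set (S1 := sumR (fun e => X e * p e) s0). set (S0 := sumR p s0) in *.
    set (S2 := sumR _ s0).
    assert (0 <= (X m - S1 / S0) ^ 2 * S0) as Sq by (apply Rmult_le_pos; [apply pow2_ge_0|lra]).
    replace ((X m - S1 / S0) ^ 2 * S0) with (X m ^ 2 * S0 - 2 * X m * S1 + S1 ^ 2 / S0) in Sq by (field; lra).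
    lra. }
  assert (p m <= sumR p s0) as Hpm by now apply sumR_in.
  (* Shifting exponents by m extracts the factor [p m], at most the total mass, and leaves terms n^2
     u^n with u = x^2 and distinct n. *)
  rewrite (sumR_ext _ (fun e => p m / x ^ 2 * (INR (e - m) ^ 2 * (x ^ 2) ^ (e - m)))).
  2:{ intros e He. specialize (Hmin e He). unfold p.
      replace (INR e - INR e0) with (INR m - INR e0 + INR (e - m)) by (rewrite minus_INR; [ring|lia]).
      rewrite Rpower_plus Rpower_pow; [|lra]. rewrite Rpow_mult_distr.
      replace (X e - X m) with (INR (e - m) / x) by (unfold X; rewrite minus_INR; [field; lra|lia]).
      rewrite <- !pow_mult, (Nat.mul_comm 2). field. lra. }
  rewrite sumR_scal.
  assert (0 < x ^ 2 < 1) as Hu by nra.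
  pose proof (sum_sqr_pow_le (x ^ 2) (map (fun e => (e - m)%nat) s0) Hu) as K.
  rewrite sumR_map in K.
  assert (NoDup (map (fun e => (e - m)%nat) s0)) as HNm.
  { apply NoDup_map_NoDup_ForallPairs; auto. intros a b Ha Hb E.
    pose proof (Hmin a Ha). pose proof (Hmin b Hb). lia. }
  specialize (K HNm).
  assert (0 < (1 - x ^ 2) ^ 3) as H3 by (apply pow_lt; lra).
  apply Rle_trans with (p m / x ^ 2 * (x ^ 2 * (1 + x ^ 2) / (1 - x ^ 2) ^ 3)).
  { apply Rmult_le_compat_l; auto. apply Rdiv_le_0_compat; auto. lra. }
  replace (p m / x ^ 2 * (x ^ 2 * (1 + x ^ 2) / (1 - x ^ 2) ^ 3)) with
    (p m * ((1 + x ^ 2) / (1 - x ^ 2) ^ 3)) by (field; split; lra).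
  apply Rmult_le_compat_r; auto. apply Rdiv_le_0_compat; lra.
Qed.

(* Density of the claimed upper bound, times [sqrt (2 * PI)]. *)
Definition weight (x : R) : R := (/ (1 - x) + 2 / ((1 - x) * sqrt (1 - x))) / sqrt (2 * PI).

Lemma weight_pos x : x < 1 -> 0 < weight x.
Proof.
  intros H. pose proof sqrt_2PI_pos. assert (0 < sqrt (1 - x)) by (apply sqrt_lt_R0; lra).
  unfold weight. apply Rdiv_lt_0_compat; auto.
  apply Rplus_lt_0_compat; [apply Rinv_0_lt_compat; lra|apply Rdiv_lt_0_compat; nra].
Qed.

(** With y = sqrt(1 - x) the powers y^6 cancel, leaving (1 + x^2) 2 PI <= (y + 2)^2 (1 + x) (1 +
    x)^2. Here 2 PI <= 8, 1 + x^2 <= (1 + x)^2, and 8 <= (y + 2)^2 (2 - y^2) on [0, 1], with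
    equality at y = 0 thanks to the coefficient 2 in [weight]. *)
Lemma weight_sqr_ge x : 0 < x < 1 -> (1 + x ^ 2) / (1 - x ^ 2) ^ 3 <= weight x ^ 2.
Proof.
  intros Hx. pose (y := sqrt (1 - x)). assert (0 < y) as Hy by (apply sqrt_lt_R0; lra).
  assert (y ^ 2 = 1 - x) as Ey by (unfold y; rewrite pow2_sqrt; lra).
  assert (y < 1) as Hy1 by nra.
  pose proof sqrt_2PI_pos as Hs. pose proof PI_4. pose proof PI_RGT_0.
  assert (weight x ^ 2 = (y + 2) ^ 2 / (y ^ 6 * (2 * PI))) as ->.
  { unfold weight. fold y. rewrite <- Ey.
    transitivity ((y + 2) ^ 2 / (y ^ 6 * (sqrt (2 * PI) ^ 2))); [field; lra|].
    rewrite pow2_sqrt; [reflexivity|lra]. }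
  replace ((1 - x ^ 2) ^ 3) with (y ^ 6 * (1 + x) ^ 3)
    by (replace (y ^ 6) with ((y ^ 2) ^ 3) by ring; rewrite Ey; ring).
  assert (0 < y ^ 6) as H6 by (apply pow_lt; lra).
  assert (0 < (1 + x) ^ 3) as H3 by (apply pow_lt; lra).
  apply Rmult_le_reg_r with (y ^ 6 * ((1 + x) ^ 3 * (2 * PI))).
  { apply Rmult_lt_0_compat; [assumption|]. apply Rmult_lt_0_compat; lra. }
  replace ((1 + x ^ 2) / (y ^ 6 * (1 + x) ^ 3) * (y ^ 6 * ((1 + x) ^ 3 * (2 * PI))))
    with ((1 + x ^ 2) * (2 * PI)) by (field; lra).
  replace ((y + 2) ^ 2 / (y ^ 6 * (2 * PI)) * (y ^ 6 * ((1 + x) ^ 3 * (2 * PI))))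
    with ((y + 2) ^ 2 * (1 + x) * (1 + x) ^ 2) by (field; lra).
  assert (8 <= (y + 2) ^ 2 * (1 + x)) as H8.
  { replace (1 + x) with (2 - y ^ 2) by lra.
    replace ((y + 2) ^ 2 * (2 - y ^ 2)) with (8 + y * (8 - 2 * y - 4 * y ^ 2 - y ^ 3)) by ring.
    assert (0 <= 8 - 2 * y - 4 * y ^ 2 - y ^ 3) by nra. nra. }
  apply Rle_trans with ((1 + x) ^ 2 * 8); [|nra].
  apply Rmult_le_compat; nra.
Qed.

(** Only a majorant [F] with a computable expectation is asked for, so the expectation of the
    integrand itself need not be shown to exist. *)
Lemma kac_expectation_le (s : list nat) (e0 : nat) x : NoDup (s ++ [e0]) -> 0 < x < 1 ->
  let Z := map (fun e => INR e - INR e0) s in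
  exists F v, gauss_exp (length Z) F v /\ (forall T, length T = length Z -> kacT Z T x <= F T) /\
    v <= weight x / sqrt (2 * PI).
Proof.
  intros HN Hx Z. pose (al := map (Rpower x) Z). pose (be := map (fun z => z * Rpower x (z - 1)) Z).
  pose proof (exponent_variance_le s e0 x HN Hx) as HV. cbv zeta in HV. fold Z al be in HV.
  pose (S0 := 1 + dot al al). fold S0 in HV. pose proof (dot_self_nonneg al).
  assert (0 < S0) as HS by (unfold S0; lra).
  pose (w := weight x). assert (0 < w) as Hw by (apply weight_pos; lra).
  pose proof (weight_sqr_ge x Hx) as HW. fold w in HW. pose proof sqrt_2PI_pos as Hpi.
  assert (0 < sqrt S0) as HqS by now apply sqrt_lt_R0.
  assert (sqrt S0 ^ 2 = S0) as EqS by (rewrite pow2_sqrt; lra).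
  (* This makes 1 / lam^2 = S0 w^2, the available bound on the variance term, so the two halves of
     the quadratic majorant are balanced. *)
  pose (lam := / (sqrt S0 * w)). assert (0 < lam) as Hl by (apply Rinv_0_lt_compat; nra).
  pose proof (gauss_exp_scal _ (lam / 2 / sqrt (2 * PI)) _ _ (gauss_exp_tilted (length Z) al be (/ lam ^ 2) 0 0
    ltac:(unfold al; now rewrite length_map) ltac:(unfold be; now rewrite length_map))) as K.
  eexists. eexists. split; [exact K|]. split.
  - intros T HT. cbv beta. unfold kacT, kac, level, dlevel. fold al be.
    rewrite Rabs_Ropp. unfold gauss_density.
    replace (- (- dot T al) ^ 2 / 2) with (- (0 + dot T al) ^ 2 / 2) by field.
    rewrite !Rplus_0_l. set (E := exp _). set (b := dot T be). pose proof (pow2_abs b) as Eb.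
    replace (lam / 2 / sqrt (2 * PI) * ((/ lam ^ 2 + b ^ 2) * E)) with
      ((/ lam + lam * b ^ 2) / 2 * (E / sqrt (2 * PI))) by (field; lra).
    apply Rmult_le_compat_r; [left; apply Rdiv_lt_0_compat; [apply exp_pos|auto]|].
    rewrite <- Eb. pose proof (pow2_ge_0 (lam * Rabs b - 1)).
    apply Rmult_le_reg_r with (2 * lam); [lra|].
    replace ((/ lam + lam * Rabs b ^ 2) / 2 * (2 * lam)) with (1 + lam ^ 2 * Rabs b ^ 2) by (field; lra).
    nra.
  - fold S0. set (V := dot be be - dot al be ^ 2 / S0) in HV.
    assert (V <= S0 * w ^ 2) as HV2.
    { apply Rle_trans with (1 := HV). apply Rmult_le_compat_l; lra. }
    replace (- 0 ^ 2 / (2 * S0)) with 0 by (field; lra). rewrite exp_0.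
    replace (/ lam ^ 2 + (0 - 0 * dot al be / S0) ^ 2 + dot be be - dot al be ^ 2 / S0)
      with (/ lam ^ 2 + V) by (unfold V; field; lra).
    replace (/ lam ^ 2) with (S0 * w ^ 2)
      by (unfold lam; rewrite <- EqS at 1; field; lra).
    unfold Rdiv at 2 4. rewrite (Rmult_comm (w)).
    apply Rle_trans with (lam / 2 * / sqrt (2 * PI) * ((2 * S0 * w ^ 2) * 1 * / sqrt S0)).
    + apply Rmult_le_compat_l.
      { apply Rmult_le_pos; [lra|left; now apply Rinv_0_lt_compat]. }
      apply Rmult_le_compat_r; [left; now apply Rinv_0_lt_compat|]. lra.
    + right. unfold lam. rewrite <- EqS at 2. field. lra.
Qed.

Lemma left_sum_expectation_le (s : list nat) (e0 : nat) a D N : NoDup (s ++ [e0]) ->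
  0 < a -> 0 <= D -> a + INR N * D < 1 ->
  let Z := map (fun e => INR e - INR e0) s in
  exists F v, gauss_exp (length Z) F v /\
    (forall T, length T = length Z -> left_sum (kacT Z T) a D N <= F T) /\
    v <= left_sum (fun x => weight x / sqrt (2 * PI)) a D N.
Proof.
  intros HN Ha HD. induction N as [|N IH]; intros HN1 Z.
  - exists (fun _ => 0), 0. split; [apply gauss_exp_const|]. simpl. split; [intros; lra|lra].
  - rewrite S_INR in HN1. pose proof (pos_INR N).
    destruct IH as [F [v [H1 [H2 H3]]]]; [nra|]. fold Z in H1, H2.
    destruct (kac_expectation_le s e0 (a + INR N * D) HN) as [F' [v' [K1 [K2 K3]]]]; [nra|].
    fold Z in K1, K2.
    exists (fun T => F T + D * F' T), (v + D * v').
    split; [apply gauss_exp_plus; auto; now apply gauss_exp_scal|]. cbn [left_sum]. split.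
    + intros T HT. specialize (H2 T HT). specialize (K2 T HT). nra.
    + nra.
Qed.

Definition bound_primitive (x : R) : R := / (2 * PI) * (4 / sqrt (1 - x) - ln (1 - x)).

Lemma is_derive_bound_primitive x : x < 1 ->
  is_derive bound_primitive x (weight x / sqrt (2 * PI)).
Proof.
  intros Hx. pose proof sqrt_2PI_pos. pose proof PI_RGT_0.
  assert (0 < sqrt (1 - x)) as Hy by (apply sqrt_lt_R0; lra).
  unfold bound_primitive. auto_derive; change (1 + - x) with (1 - x); [repeat split; lra|].
  unfold weight.
  assert (forall A, A / sqrt (2 * PI) / sqrt (2 * PI) = A / (2 * PI)) as E.
  { intros A. transitivity (A / (sqrt (2 * PI) ^ 2)); [field; lra|]. rewrite pow2_sqrt; lra. }
  rewrite E. set (y := sqrt (1 - x)) in *.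
  replace (1 - x) with (y ^ 2) by (unfold y; rewrite pow2_sqrt; lra). field. lra.
Qed.

Lemma weight_le x y : x <= y -> y < 1 -> weight x <= weight y.
Proof.
  intros Hxy Hy. pose proof sqrt_2PI_pos.
  assert (0 < sqrt (1 - y)) by (apply sqrt_lt_R0; lra).
  assert (sqrt (1 - y) <= sqrt (1 - x)) by (apply sqrt_le_1; lra).
  unfold weight. apply Rmult_le_compat_r; [left; now apply Rinv_0_lt_compat|].
  apply Rplus_le_compat; [apply Rinv_le_contravar; lra|].
  apply Rmult_le_compat_l; [lra|]. apply Rinv_le_contravar; [nra|]. apply Rmult_le_compat; lra.
Qed.

(** [weight] is increasing, so left sums stay below the integral: this is the reason for left
    nodes. *)
Lemma left_sum_weight_le a D N : 0 < a -> 0 < D -> a + INR N * D < 1 ->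
  left_sum (fun x => weight x / sqrt (2 * PI)) a D N <=
    bound_primitive (a + INR N * D) - bound_primitive a.
Proof.
  intros Ha HD. induction N as [|N IH]; intros HN.
  - simpl. rewrite Rmult_0_l Rplus_0_r. lra.
  - cbn [left_sum]. rewrite S_INR in HN |- *. pose proof (pos_INR N).
    specialize (IH ltac:(nra)). set (c := a + INR N * D) in *.
    replace (a + (INR N + 1) * D) with (c + D) in * by (unfold c; ring).
    destruct (MVT_gen bound_primitive c (c + D) (fun x => weight x / sqrt (2 * PI))) as [t [Ht E]].
    + rewrite Rmin_left; [|lra]. rewrite Rmax_right; [|lra]. intros x Hx.
      apply is_derive_bound_primitive. lra.
    + rewrite Rmin_left; [|lra]. rewrite Rmax_right; [|lra]. intros x Hx.
      apply derivable_continuous_pt. eexists. apply is_derive_Reals, is_derive_bound_primitive. lra.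
    + rewrite Rmin_left in Ht; [|lra]. rewrite Rmax_right in Ht; [|lra].
      replace (c + D - c) with D in E by ring.
      assert (weight c / sqrt (2 * PI) <= weight t / sqrt (2 * PI)).
      { apply Rmult_le_compat_r; [left; apply Rinv_0_lt_compat, sqrt_2PI_pos|]. apply weight_le; lra. }
      cbv beta in E. nra.
Qed.

Lemma bound_primitive_le x y : x <= y -> y < 1 -> bound_primitive x <= bound_primitive y.
Proof.
  intros Hxy Hy. destruct (MVT_gen bound_primitive x y (fun x => weight x / sqrt (2 * PI))) as [t [Ht E]].
  - rewrite Rmin_left // Rmax_right //. intros t Ht. apply is_derive_bound_primitive. lra.
  - rewrite Rmin_left // Rmax_right //. intros t Ht.
    apply derivable_continuous_pt. eexists. apply is_derive_Reals, is_derive_bound_primitive. lra.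
  - rewrite Rmin_left // Rmax_right // in Ht. cbv beta in E.
    assert (0 < weight t / sqrt (2 * PI)).
    { apply Rdiv_lt_0_compat; [apply weight_pos; lra|apply sqrt_2PI_pos]. }
    nra.
Qed.

(** * Expected number of zeros *)

Lemma poly_eval_level (s : list nat) (e0 : nat) T t x : length T = length s -> 0 < x ->
  poly_eval (s ++ [e0]) (T ++ [t]) x =
    x ^ e0 * (t - level (map (fun e => INR e - INR e0) s) T x).
Proof.
  intros HT Hx. unfold level. revert T HT.
  induction s as [|e s IH]; intros [|u T] HT; try easy.
  - unfold poly_eval. simpl. ring.
  - unfold poly_eval in *. simpl in *. rewrite (IH T ltac:(lia)).
    assert (x ^ e = x ^ e0 * Rpower x (INR e - INR e0)) as ->; [|ring].
    rewrite <- !Rpower_pow, <- Rpower_plus; auto. f_equal. ring.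
Qed.

Lemma nzeros_eq s a lo hi l : is_zero_list s a lo hi l -> nzeros s a lo hi = INR (length l).
Proof.
  intros [HN H]. unfold nzeros. destruct excluded_middle_informative as [E|E].
  - destruct constructive_indefinite_description as [l' [HN' H']]. simpl. f_equal.
    apply Nat.le_antisymm; apply NoDup_incl_length; auto; intros x Hx.
    + apply H. now apply H'.
    + apply H'. now apply H.
  - exfalso. apply E. exists l. now split.
Qed.

Lemma unit_separated_exponents (s : list nat) (e0 : nat) : NoDup (s ++ [e0]) ->
  unit_separated (map (fun e => INR e - INR e0) s).
Proof.
  intros HN. assert (NoDup s /\ ~ In e0 s) as [HNs He0].
  { apply NoDup_remove in HN. now rewrite app_nil_r in HN. }
  assert (forall a b : nat, (a < b)%nat -> INR a + 1 <= INR b) as Hlt.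
  { intros a b Hab. rewrite <- S_INR. apply le_INR. lia. }
  repeat split.
  - apply Injective_map_NoDup; auto. intros a b Hab. apply INR_eq. lra.
  - intros z Hz. apply in_map_iff in Hz. destruct Hz as [e [<- He]].
    assert (e <> e0) as Hne by congruence. apply Nat.lt_gt_cases in Hne. destruct Hne as [L|L].
    + specialize (Hlt _ _ L). rewrite Rabs_left; lra.
    + specialize (Hlt _ _ L). rewrite Rabs_right; lra.
  - intros y z Hy Hz Hyz. apply in_map_iff in Hy. apply in_map_iff in Hz.
    destruct Hy as [a [<- Ha]]. destruct Hz as [b [<- Hb]].
    assert (a < b)%nat as L by (apply INR_lt; lra). specialize (Hlt _ _ L). lra.
Qed.

Lemma dot_zero T L : (forall t, In t T -> t = 0) -> dot T L = 0.
Proof.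
  revert L. induction T as [|t T IH]; intros [|l L] H; simpl; auto.
  rewrite (H t (or_introl eq_refl)) IH; [ring|]. intros u Hu. apply H. now right.
Qed.

(** The derivative of [level] is again a generalised polynomial, with coefficients t z and exponents
    z - 1. Its number of zeros is bounded in terms of the number of exponents alone, which makes the
    bound on V uniform in T. *)
Lemma conditional_expected_zeros (s : list nat) (e0 : nat) r : NoDup (s ++ [e0]) -> 0 < r < 1 ->
  let Z := map (fun e => INR e - INR e0) s in
  exists B, forall T, length T = length Z -> exists V, 0 <= V <= B /\
    kac_integral (level Z T) (dlevel Z T) 0 r V /\
    gauss_exp 1 (fun l => nzeros (s ++ [e0]) (T ++ l) 0 r) V.
Proof.
  intros HN Hr Z. destruct (gpoly_zeros (length Z)) as [B HB].
  destruct (unit_separated_exponents s e0 HN) as [HNZ [HZ1 _]]. fold Z in HNZ, HZ1.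
  assert (length Z = length s) as HZs by (unfold Z; now rewrite length_map).
  assert (forall T t x, length T = length Z -> 0 < x ->
    (poly_eval (s ++ [e0]) (T ++ [t]) x = 0 <-> level Z T x = t)) as HP.
  { intros T t x HT Hx. rewrite poly_eval_level; [|lia|auto]. fold Z.
    pose proof (pow_lt x e0 Hx). split; intros E.
    - apply Rmult_integral in E. lra.
    - rewrite E. ring. }
  exists (2 ^ B). intros T HT.
  destruct (classic (exists t, In t T /\ t <> 0)) as [Hnz|Hz].
  - destruct (HB (zipmul T Z) (map (fun z => z - 1) Z)) as [L [HL HLx]].
    { now rewrite length_map. }
    { now rewrite length_zipmul. }
    { apply Injective_map_NoDup; auto. intros a b Hab. lra. }
    { apply zipmul_neq0; auto. intros z Hz E. specialize (HZ1 z Hz). rewrite E Rabs_R0 in HZ1. lra. }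
    destruct (crossings_integral (level Z T) (dlevel Z T) L (C1_pos_level Z T) 0 r ltac:(lra))
      as [V [HV [[N [Lx [HN1 HN2]]] HK]]].
    { intros x Hx E. apply HLx; [lra|]. rewrite dot_zipmul map_map.
      rewrite <- (map_id Z) at 1. rewrite zipmul_map. unfold dlevel in E. lra. }
    exists V. split; [|split; [exact HK|]].
    + split; [apply (kac_integral_nonneg _ _ 0 r _ (C1_pos_level Z T) ltac:(lra) HK)|].
      apply Rle_trans with (1 := HV). apply Rle_pow; [lra|exact HL].
    + exists (fun t => nzeros (s ++ [e0]) (T ++ [t]) 0 r). split; [reflexivity|].
      apply improper_int_ext_off_list with (2 := HN2) (L := Lx). intros t Ht. f_equal.
      destruct (HN1 t Ht) as [l [Hl1 [Hl2 ->]]]. symmetry. apply nzeros_eq. split; auto.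
      intros x. rewrite Hl2. split; intros [H1 H2]; (split; [exact H1|]); apply HP; auto; lra.
  - assert (forall t, In t T -> t = 0) as H0.
    { intros t Ht. apply NNPP. intros Hn. apply Hz. now exists t. }
    (* With all other coefficients 0 the polynomial is the single monomial t x^e0: no zeros for t <>
       0, and the value t = 0 is one exceptional point. *)
    exists 0. split; [|split].
    + split; [lra|]. apply pow_le. lra.
    + assert (forall a, 0 < a < r -> RInt (kac (level Z T) (dlevel Z T)) a r = 0) as K.
      { intros a Ha. apply is_RInt_unique, is_RInt_zero; [lra|]. intros x _.
        unfold kac, dlevel. rewrite dot_zero; auto. rewrite Ropp_0 Rabs_R0. ring. }
      split.
      * intros y [a [Ha ->]]. rewrite K; auto. lra.
      * intros w Hw. apply Hw. exists (r / 2). split; [lra|]. rewrite K; auto; lra.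
    + exists (fun t => nzeros (s ++ [e0]) (T ++ [t]) 0 r). split; [reflexivity|].
      pose proof (improper_int_scal _ _ 0 improper_int_gauss) as I. rewrite Rmult_0_l in I.
      apply improper_int_ext_off_list with (2 := I) (L := [0]). intros t Ht. f_equal.
      symmetry. apply (nzeros_eq _ _ _ _ nil). split; [constructor|]. intros x. split; [easy|].
      intros [Hx E]. apply HP in E; auto; [|lra]. unfold level in E. rewrite dot_zero in E; auto.
      exfalso. apply Ht. left. lra.
Qed.

Lemma left_sum_nonneg q a D N : (forall x, 0 <= q x) -> 0 <= D -> 0 <= left_sum q a D N.
Proof.
  intros Hq HD. induction N as [|N IH]; simpl; [lra|]. specialize (Hq (a + INR N * D)). nra.
Qed.

Theorem theorem1p4 (eps : R) (s : list nat) :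
  0 < eps < 1 -> s <> nil -> NoDup s ->
  exists z, expected_zeros s 0 (1 - eps) z /\
    z <= / (2 * PI) * (ln (2 / eps) + 4 / sqrt eps - 4).
Proof.
  intros Heps Hs HN. destruct (exists_last Hs) as [s' [e0 ->]].
  pose (r := 1 - eps). assert (0 < r < 1) as Hr by (unfold r; lra). fold r.
  pose (Z := map (fun e => INR e - INR e0) s').
  pose proof (unit_separated_exponents s' e0 HN) as HZ. fold Z in HZ.
  destruct (conditional_expected_zeros s' e0 r HN Hr) as [B HB]. fold Z in HB.
  (* The length guard sits under the existential so that choice yields a total function; its values
     at lists of other lengths are arbitrary. *)
  assert (forall T, exists V, length T = length Z -> 0 <= V <= B /\
    kac_integral (level Z T) (dlevel Z T) 0 r V /\
    gauss_exp 1 (fun l => nzeros (s' ++ [e0]) (T ++ l) 0 r) V) as HB'.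
  { intros T. destruct (classic (length T = length Z)) as [E|E]; [|now exists 0].
    destruct (HB T E) as [V HV]. now exists V. }
  pose (V := fun T => proj1_sig (constructive_indefinite_description _ (HB' T))).
  assert (forall T, length T = length Z -> 0 <= V T <= B /\
    kac_integral (level Z T) (dlevel Z T) 0 r (V T) /\
    gauss_exp 1 (fun l => nzeros (s' ++ [e0]) (T ++ l) 0 r) (V T)) as HV.
  { intros T HT. unfold V. destruct constructive_indefinite_description as [v Hv]. now apply Hv. }
  destruct (gauss_exp_exists (length Z) B V) as [v [Hv _]].
  { apply stratified_kac_integral with r; auto. intros T HT. now destruct (HV T HT) as [? [? _]]. }
  exists v. split.
  - unfold expected_zeros. rewrite length_app Nat.add_1_r.
    replace (length s') with (length Z) by (unfold Z; apply length_map).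
    apply gauss_exp_snoc with V; auto. intros T HT. now apply HV.
  - apply Rle_trans with (bound_primitive r - bound_primitive 0).
    + apply le_epsilon. intros e He.
      assert (0 <= B) as HB0.
      { destruct (HV (repeat 0 (length Z)) (repeat_length _ _)) as [? _]. lra. }
      (* The box depends on B and e only. The nodes are fitted to it afterwards, and [HBox] applies
         to whatever majorant [F] they produce. *)
      destruct (gauss_exp_le_on_box (length Z) B (e / 2) HB0 ltac:(lra)) as [d [M [Hd HBox]]].
      destruct (kac_integral_approx Z d M r (e / 2) HZ ltac:(lra) Hr ltac:(lra))
        as [a [D [N [Ha [HD [Er HA]]]]]].
      destruct (left_sum_expectation_le s' e0 a D N HN Ha ltac:(lra) ltac:(lra)) as [F [w [F1 [F2 F3]]]].
      fold Z in F1, F2.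
      assert (v <= w + e / 2 + e / 2) as Hvw.
      { apply (HBox V F v w (e / 2)); auto; [lra| |].
        (* Off the box V T <= B <= F T + B is enough, [F] being above a nonnegative left sum. *)
        - intros T HT. destruct (HV T HT) as [? _]. specialize (F2 T HT).
          pose proof (left_sum_nonneg (kacT Z T) a D N (kac_nonneg _ _) ltac:(lra)). lra.
        - intros T HT Hbox. destruct (HV T HT) as [_ [K _]]. specialize (F2 T HT).
          assert (on_stratum d M T) as HS.
          { intros t Ht. right. rewrite -> List.Forall_forall in Hbox. now apply Hbox. }
          pose proof (HA T (V T) HT HS K) as K2. apply Rabs_le_between in K2. lra. }
      pose proof (left_sum_weight_le a D N Ha HD ltac:(lra)) as F4. rewrite Er in F4.
      pose proof (bound_primitive_le 0 a ltac:(lra)).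
      pose proof (pos_INR N). assert (a < 1) by nra. lra.
    (* Up to the factor 1 / (2 PI) the increment equals 4 / sqrt eps - 4 - ln eps; the claim leaves
       a slack of ln 2. *)
    + unfold bound_primitive, r. replace (1 - (1 - eps)) with eps by ring.
      rewrite Rminus_0_r sqrt_1 ln_1. unfold Rdiv at 3. rewrite ln_mult; [|lra|apply Rinv_0_lt_compat; lra].
      rewrite ln_Rinv; [|lra]. pose proof PI_RGT_0.
      assert (0 < / (2 * PI)) by (apply Rinv_0_lt_compat; lra).
      assert (0 < ln 2) by (rewrite <- ln_1; apply ln_increasing; lra).
      rewrite <- Rmult_minus_distr_l. apply Rmult_le_compat_l; [lra|]. lra.
Qed.
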